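(* Let $\mathsf{M}\in\mathbb{C}^{D\times D}$ be a matrix with no eigenvalues on the closed negative real axis $(-\infty,0]$, and let $\{\mathsf{M}_{\mu\nu}\}_{1\le\mu,\nu\le n}$ be a partition of $\mathsf{M}$. Let $\mathcal{G}$ be the graph of the partition $\{(\mathsf{I}-\mathsf{M})_{\mu\nu}\}$ of $\mathsf{I}-\mathsf{M}$ (same projectors), and let $\mathcal{G}_0$ be $\mathcal{G}$ with all self-loops deleted. Then, as long as all of the required inverses (those in the definition of the quantities $\mathsf{F}$ below, for $x\in[0,1]$) exist, the partition of the principal matrix logarithm of $\mathsf{M}$ is given by $$(\log \mathsf{M})_{\alpha\alpha} = \int_0^1 x^{-1}\left(\mathsf{I}-\mathsf{F}_{\mathcal{G}}[\alpha]\right)\mathrm{d}x,$$ and, for $\omega\neq\alpha$, $$(\log \mathsf{M})_{\omega\alpha} = \sum_{P_{\mathcal{G}_0;\alpha\omega}} \int_0^1 (-x)^{\ell-1}\, \mathsf{F}_{\mathcal{G}\backslash\{\alpha,\nu_2,\ldots,\nu_\ell\}}[\omega]\, \mathsf{M}_{\omega\nu_\ell} \cdots \mathsf{F}_{\mathcal{G}\backslash\{\alpha\}}[\nu_2]\, \mathsf{M}_{\nu_2\alpha}\, \mathsf{F}_\mathcal{G}[\alpha]\,\mathrm{d}x,$$ where the sum runs over all paths $(\alpha,\nu_2,\ldots,\nu_\ell,\omega)$ from $\alpha$ to $\omega$ on $\mathcal{G}_0$, $\ell$ is the length of the path, and $\mathsf{F}$ (which depends on $x$) is defined recursively (for $\mathcal{G}$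 and, in the same way, for each graph obtained from it by deleting vertices) by $$\mathsf{F}_{\mathcal{G}}[\alpha] = \left[\mathsf{I}- x(\mathsf{I}-\mathsf{M}_\alpha)-\sum_{C_{\mathcal{G}_0;\alpha}} (-x)^m\,\mathsf{M}_{\alpha\mu_m}\, \mathsf{F}_{\mathcal{G}\backslash\{\alpha,\mu_2,\ldots,\mu_{m-1}\}}[\mu_m]\cdots \mathsf{M}_{\mu_3\mu_2}\,\mathsf{F}_{\mathcal{G}\backslash\{\alpha\}} [\mu_2]\,\mathsf{M}_{\mu_2\alpha}\right]^{-1},$$ where the sum runs over all bare cycles $(\alpha,\mu_2,\ldots,\mu_m,\alpha)$ off $\alpha$ on $\mathcal{G}_0$ and $m$ is the length of the bare cycle.
   Context: Partition of a matrix: let $V=V_1\oplus\cdots\oplus V_n=\mathbb{C}^D$, where each $V_\mu$ (of dimension $d_\mu\geq 1$) is spanned by a subset of the standard orthonormal basis vectors, these subsets being disjoint. Let $\mathsf{R}_\mu\in\mathbb{C}^{d_\mu\times D}$ be the restriction to these coordinates, so $\mathsf{R}_\mu^{\mathrm T}\mathsf{R}_\mu=\varepsilon_\mu$ is the orthogonal projector onto $V_\mu$. The corresponding partition of a $D\times D$ matrix $\mathsf{A}$ is the family $\mathsf{A}_{\mu\nu}=\mathsf{R}_\mu\mathsf{A}\mathsf{R}_\nu^{\mathrm T}$ (of size $d_\mu\times d_\nu$), $1\le\mu,\nu\le n$; equivalently, up to a permutation of the coordinates, a block decomposition of $\mathsf{A}$. One writes $\mathsf{A}_\mu=\mathsf{A}_{\mu\mu}$.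 The partition of a matrix function $f(\mathsf{M})$ is taken with the same projectors. $\mathsf{I}$ is the identity matrix of the appropriate size. Graph of a partition $\{\mathsf{A}_{\mu\nu}\}$: the directed graph with vertices labelled $1,\ldots,n$ and with a directed edge from $\nu$ to $\mu$, written $(\nu\mu)$, whenever $\mathsf{A}_{\mu\nu}\neq 0$ (self-loops included). $\mathcal{G}\backslash\{\alpha,\beta,\ldots\}$ is $\mathcal{G}$ with the vertices $\alpha,\beta,\ldots$ deleted; a subscript $0$ means that all self-loops are deleted. Path: a walk whose vertices are all distinct; its length is its number of edges. $P_{\mathcal{G};\alpha\omega}$ is the set of paths from $\alpha$ to $\omega$. Bare cycle off $\alpha$: a closed walk of positive length from $\alpha$ to $\alpha$ that does not revisit any internal vertex and visits $\alpha$ only at its ends; $C_{\mathcal{G};\alpha}$ is the set of these. An empty sum is zero, so if $\alpha$ has no neighbours in the graph, $\mathsf{F}[\alpha]=[\mathsf{I}-x(\mathsf{I}-\mathsf{M}_\alpha)]^{-1}$. The principal logarithm $\log\mathsf{M}$ is the unique logarithm of $\mathsf{M}$ all of whose eigenvalues have imaginary part in $(-\pi,\pi)$. *)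

(* Defs.v *)
From HB Require Import structures.
From mathcomp Require Import all_boot all_order all_algebra.
From mathcomp Require Import all_classical all_reals all_analysis.
From mathcomp Require Import complex.

Set Implicit Arguments.
Unset Strict Implicit.
Unset Printing Implicit Defensive.

Import Order.TTheory GRing.Theory Num.Theory.
Import numFieldNormedType.Exports.

Local Open Scope classical_set_scope.
Local Open Scope ring_scope.
Local Open Scope complex_scope.

(* [B mu] is the set of (indices of) standard basis vectors spanning V_mu. *)
Definition coord_partition (D n : nat) (B : 'I_n -> {set 'I_D}) : Prop :=
  [/\ forall mu : 'I_n, B mu != finset.set0,
      forall mu nu : 'I_n, mu != nu -> (B mu :&: B nu)%SET = finset.set0
    & forall i : 'I_D, exists mu : 'I_n, i \in B mu].

Definition restr (K : fieldType) (D n : nat) (B : 'I_n -> {set 'I_D})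
    (mu : 'I_n) : 'M[K]_(#|B mu|, D) :=
  \matrix_(k, i) (i == enum_val k)%:R.

Definition block (K : fieldType) (D n : nat) (B : 'I_n -> {set 'I_D})
    (A : 'M[K]_D) (mu nu : 'I_n) : 'M[K]_(#|B mu|, #|B nu|) :=
  restr K B mu *m A *m (restr K B nu)^T.

(* A digraph on 'I_n is its edge relation: [e nu mu] is the edge from nu to
   mu. Deleting the vertices in X is encoded by deleting all edges incident
   to X, so that no walk of positive length meets X. *)
Definition partition_graph (K : fieldType) (D n : nat)
    (B : 'I_n -> {set 'I_D}) (A : 'M[K]_D) : rel 'I_n :=
  fun nu mu => block B A mu nu != 0.

Definition delete_vertices (n : nat) (X : {set 'I_n}) (e : rel 'I_n) :
    rel 'I_n :=
  fun u v => [&& e u v, u \notin X & v \notin X].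

Definition delete_loops (n : nat) (e : rel 'I_n) : rel 'I_n :=
  fun u v => e u v && (u != v).

(* A path or bare cycle (a, s_1, ..., s_k, w) is given by its end points and
   the sequence s of its internal vertices; its length is k + 1. *)
Definition is_path (n : nat) (e : rel 'I_n) (a : 'I_n) (s : seq 'I_n)
    (w : 'I_n) : bool :=
  path e a (rcons s w) && uniq (a :: rcons s w).

Definition is_bare_cycle (n : nat) (e : rel 'I_n) (a : 'I_n)
    (s : seq 'I_n) : bool :=
  path e a (rcons s a) && uniq (a :: s).

Section PathSums.
Variables (K : fieldType) (D n : nat) (B : 'I_n -> {set 'I_D}).
Variables (M : 'M[K]_D) (x : K).

Let G : rel 'I_n := partition_graph B (1%:M - M).

(* In what follows [F X a] stands for F_{G \ X}[a]. For s = (s_1, ..., s_k),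
   [walk_product F X v s w] is
     M_{w s_k} F_{G \ (X, s_1, ..., s_(k-1))}[s_k] ... F_{G \ X}[s_1] M_{s_1 v}
   and it is M_{w v} when s is empty. *)
Fixpoint walk_product (F : {set 'I_n} -> forall a, 'M[K]_#|B a|)
    (X : {set 'I_n}) (v : 'I_n) (s : seq 'I_n) (w : 'I_n) :
    'M[K]_(#|B w|, #|B v|) :=
  if s is u :: s' then
    walk_product F (u |: X)%SET u s' w *m F X u *m block B M u v
  else block B M w v.

(* No internal sequence of a bare cycle is longer than n, so that n.-bseq 'I_n
   contains them all. *)
Definition F_bracket (F : {set 'I_n} -> forall a, 'M[K]_#|B a|)
    (X : {set 'I_n}) (a : 'I_n) : 'M[K]_#|B a| :=
  1%:M - x *: (1%:M - block B M a a)
  - \sum_(s : n.-bseq 'I_n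
          | is_bare_cycle (delete_loops (delete_vertices X G)) a s)
      (- x) ^+ (size s).+1 *: walk_product F (a |: X)%SET a s a.

(* The recursion deletes at least one vertex at each step; k is fuel. See
   [pathsum_FE] below for the recursive equation. *)
Fixpoint F_fuel (k : nat) (X : {set 'I_n}) (a : 'I_n) : 'M[K]_#|B a| :=
  if k is k'.+1 then invmx (F_bracket (F_fuel k') X a) else 0.

Definition pathsum_F (X : {set 'I_n}) (a : 'I_n) : 'M[K]_#|B a| :=
  F_fuel #|(~: X)%SET| X a.

(* As [invmx] is total, the existence of the inverse defining F_{G \ X}[a],
   and of those it recursively involves, is a separate predicate. *)
Inductive F_exists (X : {set 'I_n}) (a : 'I_n) : Prop :=
  F_existsI of
    (forall s s1 mu s2,
      is_bare_cycle (delete_loops (delete_vertices X G)) a s ->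
      s = s1 ++ mu :: s2 ->
      F_exists ((a |: X) :|: [set:: s1])%SET mu)
  & F_bracket pathsum_F X a \in unitmx.

Lemma eq_walk_product F1 F2 (X : {set 'I_n}) v s w :
    (forall (Y : {set 'I_n}) u, X \subset Y -> u \notin Y -> F1 Y u = F2 Y u) ->
    uniq s -> {in s, forall u, u \notin X} ->
  walk_product F1 X v s w = walk_product F2 X v s w.
Proof.
elim: s X v => //= u s IH X v eqF /andP[us uq] sX.
rewrite (IH (u |: X)%SET) ?eqF ?sX ?mem_head //.
  by move=> Y t /finset.subUsetP[_ XY] tY; rewrite eqF.
move=> t ts; rewrite finset.in_setU1 negb_or sX ?in_cons ?ts ?orbT // andbT.
by apply: contraNneq us => <-.
Qed.

Lemma eq_F_bracket F1 F2 (X : {set 'I_n}) a :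
    (forall (Y : {set 'I_n}) u, (a |: X)%SET \subset Y -> u \notin Y ->
       F1 Y u = F2 Y u) ->
  F_bracket F1 X a = F_bracket F2 X a.
Proof.
move=> eqF; congr (_ - _); apply: eq_bigr => s /andP[ps /= /andP[aNs us]].
rewrite (eq_walk_product a a eqF us) // => u us'.
rewrite finset.in_setU1 negb_or; apply/andP; split.
  by apply: contraNneq aNs => <-.
have /(_ a (s : seq 'I_n) ps)/allP : forall b t,
    path (delete_loops (delete_vertices X G)) b (rcons t a) ->
    all (fun u => u \notin X) t.
  by move=> b t; elim: t b => //= t0 t IH b /andP[/andP[/and3P[_ _ ->] _] /IH].
exact.
Qed.

Lemma F_fuel_stable k1 k2 (X : {set 'I_n}) a : a \notin X ->
  (#|(~: X)%SET| <= k1)%N -> (#|(~: X)%SET| <= k2)%N ->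
  F_fuel k1 X a = F_fuel k2 X a.
Proof.
elim: k1 k2 X a => [|k1 IH] [|k2] X a aX //=; rewrite ?leqn0.
- by rewrite finset.cards_eq0 => /eqP/finset.setP/(_ a); rewrite !inE aX.
- by move=> _; rewrite finset.cards_eq0 => /eqP/finset.setP/(_ a); rewrite !inE aX.
move=> h1 h2; congr invmx; apply: eq_F_bracket => Y u aXY uY.
have lt: (#|(~: Y)%SET| < #|(~: X)%SET|)%N.
  apply: proper_card; rewrite finset.properC.
  apply: (fintype.proper_sub_trans _ aXY); apply/fintype.properP; split.
    exact: finset.subsetUr.
  by exists a; rewrite ?finset.setU11.
by apply: IH => //; rewrite -ltnS; apply: leq_trans lt _.
Qed.

Lemma pathsum_FE (X : {set 'I_n}) a : a \notin X ->
  pathsum_F X a = invmx (F_bracket pathsum_F X a).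
Proof.
move=> aX; rewrite {1}/pathsum_F.
rewrite (@F_fuel_stable _ #|(~: X)%SET|.+1) //=; congr invmx.
apply: eq_F_bracket => Y u aXY uY; apply: F_fuel_stable => //.
rewrite fintype.subset_leq_card // finset.setCS.
exact: fintype.subset_trans (finset.subsetUr _ _) aXY.
Qed.

End PathSums.

Definition is_mxexp (K : numFieldType) (D : nat) (L E : 'M[K]_D) : Prop :=
  (fun N => \sum_(k < N) (k`!%:R)^-1 *: L ^+ k) @ \oo --> E.

Definition is_principal_log (R : realType) (D : nat) (M L : 'M[R[i]]_D) :
    Prop :=
  is_mxexp L M /\
  (forall a : R[i], eigenvalue L a -> - pi < complex.Im a < pi).

(* "The" principal logarithm; 0 by default if there is none. *)
Definition principal_log (R : realType) (D : nat) (M : 'M[R[i]]_D) :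
    'M[R[i]]_D :=
  xget 0 [set L | is_principal_log M L].

(* Entrywise Lebesgue integral over [0, 1]; the value of the integrand at the
   single point 0 is immaterial. *)
Definition mx_integrable01 (R : realType) (p q : nat)
    (f : R -> 'M[R[i]]_(p, q)) : Prop :=
  forall j k,
    lebesgue_measure.-integrable `[0, 1] (EFin \o (fun x => complex.Re (f x j k)))
    /\
    lebesgue_measure.-integrable `[0, 1] (EFin \o (fun x => complex.Im (f x j k))).

Definition mx_integral01 (R : realType) (p q : nat)
    (f : R -> 'M[R[i]]_(p, q)) : 'M[R[i]]_(p, q) :=
  \matrix_(j, k)
    ((\int[lebesgue_measure]_(x in `[0%R, 1%R]) complex.Re (f x j k))%R +i*
     (\int[lebesgue_measure]_(x in `[0%R, 1%R]) complex.Im (f x j k))%R).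

(* Main.v *)
Require Import Defs.
From HB Require Import structures.
From mathcomp Require Import all_boot all_order all_algebra.
From mathcomp Require Import all_classical all_reals all_analysis.
From mathcomp Require Import complex.
From mathcomp Require Import spectral ring lra.

(** Write [A x = 1 - x (1 - M)] and [K x = (M - 1) (A x)^-1], which is continuous
on [[0, 1]] because [M] has no eigenvalue in [(-oo, 0]].

The principal logarithm is the integral of [K].  Let [L] be the primitive of [K]
vanishing at 0.  As [A' = K A] and [L] commutes with [K], differentiating the
partial sums of [exp (L 1 - L t)] times [A t] leaves one term, which tends to 0
uniformly; hence [exp (L 1) = A 1 = M].  On a common eigenvector, the imaginary
part of the eigenvalue of [L 1] is a difference of two arctangents, so that it
lies in [(-pi, pi)].  Another principal logarithm [L'] commutes with [L 1]; on a
common eigenvector in the row space of [L' - L 1] both have the same eigenvalue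
[a], and comparing the two exponentials there gives [exp a = 0] unless
[L' = L 1].

The path sums express blocks of [(A x)^-1], by deleting one vertex after the
other from the block linear system.  This needs all the principal submatrices of
[A x] to be invertible, which the existence of the [F]'s does not imply; but as
[A 0 = 1], it fails only for finitely many [x], which integrals ignore. *)

Set Implicit Arguments.
Unset Strict Implicit.
Unset Printing Implicit Defensive.

Import Order.TTheory GRing.Theory Num.Theory.
Import numFieldNormedType.Exports.

Local Open Scope classical_set_scope.
Local Open Scope ring_scope.
Local Open Scope complex_scope.

(* The topology of [R[i]] is inferred from its [numFieldType] structure only. *)
Definition complexNF (R : realType) : numFieldType := Num.NumField.clone R[i] _.

(** * Convergence in the complex numbers through real and imaginary parts *)

Section ComplexTopology.
Variable R : realType.
Local Notation C := (complexNF R).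

Lemma real_complex_continuous : continuous (fun x : R => x%:C : C).
Proof.
move=> x; apply/cvgrPdist_lt => e; rewrite ltcE /= => /andP[/eqP ei e0].
near=> y; rewrite -rmorphB /= normc_def /= expr0n addr0 sqrtr_sqr ltcE /= ei eqxx /=.
by near: y; apply: cvgr_dist_lt.
Unshelve. all: by end_near. Qed.

Lemma Re_continuous : continuous (fun z : C => complex.Re z : R).
Proof.
move=> z; apply/(@cvgrPdist_lt R R C (nbhs z) (nbhs_filter z)) => e e0; apply/nbhs_ballP.
exists e%:C => /=; first by rewrite ltcR.
move=> y /= zy; rewrite -ltcR; apply: le_lt_trans zy.
by rewrite -(raddfB (@complex.Re R : Rcomplex R -> R)) normc_ge_Re.
Qed.

Lemma Im_continuous : continuous (fun z : C => complex.Im z : R).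
Proof.
move=> z; have -> : (fun z : C => complex.Im z : R) =
   (fun z : C => complex.Re z : R) \o (fun z : C => - 'i%C * z).
  by apply/funext => -[a b] /=; simpc.
by apply: continuous_comp; [apply: mulrl_continuous|apply: Re_continuous].
Qed.

Lemma cvg_ReIm (T : Type) (F : set_system T) (FF : Filter F) (f : T -> C) (l : C) :
  complex.Re (f x) @[x --> F] --> complex.Re l ->
  complex.Im (f x) @[x --> F] --> complex.Im l -> f x @[x --> F] --> l.
Proof.
move=> fr fi; rewrite (complexE l).
rewrite (_ : f = fun x => (complex.Re (f x))%:C + 'i%C * (complex.Im (f x))%:C); last first.
  by apply/funext => x; rewrite -complexE.
have fr' : (complex.Re (f x))%:C @[x --> F] --> ((complex.Re l)%:C : C).
  exact: (cvg_comp _ _ fr (@real_complex_continuous _)).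
have fi' : (complex.Im (f x))%:C @[x --> F] --> ((complex.Im l)%:C : C).
  exact: (cvg_comp _ _ fi (@real_complex_continuous _)).
have ci : (fun=> 'i%C : C) @ F --> ('i%C : C) by exact: cvg_cst.
exact: (@cvgD C C T F FF _ _ _ _ fr' (@cvgM C T F FF _ _ _ _ ci fi')).
Qed.

Lemma mx_cvgP (T : Type) (F : set_system T) (FF : Filter F) p q
    (f : T -> 'M[C]_(p, q)) (l : 'M[C]_(p, q)) :
  (forall i j, f x i j @[x --> F] --> l i j) -> f x @[x --> F] --> l.
Proof.
move=> fl A [P /= Pl sPA].
suff : \forall x \near F, forall i j, P i j (f x i j) by apply: filterS => x; exact: sPA.
apply: filter_forall => i; apply: filter_forall => j; exact: fl (Pl i j).
Qed.

End ComplexTopology.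

(** * Continuity on [[0, 1]] of scalar and matrix functions *)

Section Cont01.
Variable R : realType.
Implicit Types K : numFieldType.

(** Continuity within the segment depends only on the values there, so that it passes to inverses
    known to exist only on [[0, 1]]. *)
Definition cont01 K (f : R -> K) := {within `[0%R, 1%R], continuous f}.

Lemma cont01_eq K (f g : R -> K) :
  (forall x, 0 <= x <= 1 -> f x = g x) -> cont01 f -> cont01 g.
Proof.
move=> fg; apply: subspace_eq_continuous => x /=.
by rewrite inE /= in_itv /= => /fg.
Qed.

Lemma cont01_cst K (c : K) : cont01 (fun=> c).
Proof. by move=> x; apply: cvg_cst. Qed.

Lemma cont01D K (f g : R -> K) : cont01 f -> cont01 g -> cont01 (fun x => f x + g x).
Proof. by move=> cf cg x; apply: continuousD; [apply: cf|apply: cg]. Qed.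

Lemma cont01M K (f g : R -> K) : cont01 f -> cont01 g -> cont01 (fun x => f x * g x).
Proof. by move=> cf cg x; apply: continuousM; [apply: cf|apply: cg]. Qed.

Lemma cont01N K (f : R -> K) : cont01 f -> cont01 (fun x => - f x).
Proof. by move=> cf x; apply: continuousN; apply: cf. Qed.

Lemma cont01V K (f : R -> K) : (forall x, 0 <= x <= 1 -> f x != 0) ->
  cont01 f -> cont01 (fun x => (f x)^-1).
Proof.
move=> f0 /subspace_continuousP cf; apply/subspace_continuousP => x xI.
by apply: cvgV; [apply: f0; move: xI; rewrite /= in_itv|apply: cf].
Qed.

Lemma cont01_sum K (I : Type) (s : seq I) (P : pred I) (f : I -> R -> K) :
  (forall i, P i -> cont01 (f i)) -> cont01 (fun x => \sum_(i <- s | P i) f i x).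
Proof.
move=> cf; elim: s => [|i s IH].
  by apply: (cont01_eq _ (@cont01_cst K 0)) => x _; rewrite big_nil.
case: (boolP (P i)) => Pi.
  apply: cont01_eq (cont01D (cf i Pi) IH) => x _.
  by rewrite big_cons Pi.
by apply: (cont01_eq _ IH) => x _; rewrite big_cons (negPf Pi).
Qed.

Lemma cont01_prod K (I : Type) (s : seq I) (f : I -> R -> K) :
  (forall i, cont01 (f i)) -> cont01 (fun x => \prod_(i <- s) f i x).
Proof.
move=> cf; elim: s => [|i s IH].
  by apply: (cont01_eq _ (@cont01_cst K 1)) => x _; rewrite big_nil.
apply: cont01_eq (cont01M (cf i) IH) => x _; by rewrite big_cons.
Qed.

Lemma cont01X K (f : R -> K) n : cont01 f -> cont01 (fun x => f x ^+ n).
Proof.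
move=> cf; elim: n => [|n IH]; first exact: cont01_cst.
by apply: cont01_eq (cont01M cf IH) => x _; rewrite exprS.
Qed.

Definition mcont01 K p q (A : R -> 'M[K]_(p, q)) :=
  forall i j, cont01 (fun x => A x i j).

Lemma mcont01_cst K p q (A : 'M[K]_(p, q)) : mcont01 (fun=> A).
Proof. by move=> i j; apply: cont01_cst. Qed.

Lemma mcont01D K p q (A B : R -> 'M[K]_(p, q)) :
  mcont01 A -> mcont01 B -> mcont01 (fun x => A x + B x).
Proof.
move=> cA cB i j; apply: cont01_eq (cont01D (cA i j) (cB i j)) => x _.
by rewrite mxE.
Qed.

Lemma mcont01N K p q (A : R -> 'M[K]_(p, q)) :
  mcont01 A -> mcont01 (fun x => - A x).
Proof. by move=> cA i j; apply: cont01_eq (cont01N (cA i j)) => x _; rewrite mxE. Qed.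

Lemma mcont01B K p q (A B : R -> 'M[K]_(p, q)) :
  mcont01 A -> mcont01 B -> mcont01 (fun x => A x - B x).
Proof. by move=> cA cB; apply: mcont01D => //; apply: mcont01N. Qed.

Lemma mcont01Z K p q (f : R -> K) (A : R -> 'M[K]_(p, q)) :
  cont01 f -> mcont01 A -> mcont01 (fun x => f x *: A x).
Proof. by move=> cf cA i j; apply: cont01_eq (cont01M cf (cA i j)) => x _; rewrite mxE. Qed.

Lemma mcont01_mul K p q r (A : R -> 'M[K]_(p, q)) (B : R -> 'M[K]_(q, r)) :
  mcont01 A -> mcont01 B -> mcont01 (fun x => A x *m B x).
Proof.
move=> cA cB i j.
apply: (@cont01_eq _ (fun x => \sum_k A x i k * B x k j)).
  by move=> x _; rewrite mxE.
by apply: cont01_sum => k _; apply: cont01M.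
Qed.

Lemma mcont01_sum K p q (I : Type) (s : seq I) (P : pred I) (A : I -> R -> 'M[K]_(p, q)) :
  (forall i, P i -> mcont01 (A i)) -> mcont01 (fun x => \sum_(i <- s | P i) A i x).
Proof.
move=> cA i j; apply: (@cont01_eq _ (fun x => \sum_(k <- s | P k) A k x i j)).
  by move=> x _; rewrite summxE.
by apply: cont01_sum => k Pk; apply: cA.
Qed.

Lemma cont01_det K n (A : R -> 'M[K]_n) : mcont01 A -> cont01 (fun x => \det (A x)).
Proof.
move=> cA; apply: cont01_sum => s _; apply: cont01M; first exact: cont01_cst.
exact: cont01_prod.
Qed.

(** By Cramer's rule, the entries of the inverse are cofactors divided by the determinant, hence
    rational in the entries of [A x]. *)
Lemma mcont01_inv K n (A : R -> 'M[K]_n) : (forall x, 0 <= x <= 1 -> A x \in unitmx) ->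
  mcont01 A -> mcont01 (fun x => invmx (A x)).
Proof.
move=> uA cA i j.
apply: (@cont01_eq _ (fun x => (\det (A x))^-1 * (\adj (A x)) i j)).
  by move=> x /uA xA; rewrite /invmx xA [RHS]mxE.
apply: cont01M.
  by apply: cont01V; [move=> x /uA; rewrite unitmxE unitfE|apply: cont01_det].
apply: (@cont01_eq _ (fun x => cofactor (A x) j i)); first by move=> x _; rewrite mxE.
apply: cont01M; first exact: cont01_cst.
apply: cont01_det => k l.
by apply: cont01_eq (cA (lift j k) (lift i l)) => x _; rewrite !mxE.
Qed.

Lemma cont01_real_complex : cont01 (fun x : R => x%:C : complexNF R).
Proof.
by apply/continuous_subspaceT => x; apply: real_complex_continuous.
Qed.

Lemma cont01_Re (f : R -> complexNF R) : cont01 f -> cont01 (fun x => complex.Re (f x) : R).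
Proof.
move=> /subspace_continuousP cf; apply/subspace_continuousP => x xI.
exact: (cvg_comp _ _ (cf x xI) (@Re_continuous _ _)).
Qed.

Lemma cont01_Im (f : R -> complexNF R) : cont01 f -> cont01 (fun x => complex.Im (f x) : R).
Proof.
move=> /subspace_continuousP cf; apply/subspace_continuousP => x xI.
exact: (cvg_comp _ _ (cf x xI) (@Im_continuous _ _)).
Qed.

Lemma cont01_ReIm (f : R -> complexNF R) : cont01 (fun x => complex.Re (f x) : R) ->
   cont01 (fun x => complex.Im (f x) : R) -> cont01 f.
Proof.
move=> /subspace_continuousP cr /subspace_continuousP ci; apply/subspace_continuousP => x xI.
by apply: cvg_ReIm; [apply: cr|apply: ci].
Qed.

Lemma cont01_integrable (f : R -> R) : cont01 f ->
  lebesgue_measure.-integrable `[0%R, 1%R] (EFin \o f).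
Proof. by apply: continuous_compact_integrable; apply: segment_compact. Qed.

Lemma cont01_bounded (f : R -> R) : cont01 f ->
  exists2 c, 0 <= c & forall x, 0 <= x <= 1 -> `|f x| <= c.
Proof.
move=> cf; have /compact_bounded : compact (f @` `[0%R, 1%R]).
  by apply: continuous_compact => //; apply: segment_compact.
move=> [c [_ fc]]; exists `|c + 1| => // x xI.
apply: (le_trans _ (ler_norm _)); apply: fc; first by rewrite ltrDl.
by exists x => //=; rewrite in_itv.
Qed.
End Cont01.

(** * Derivatives in a real variable, mean value bounds and primitives *)

Section Derivation.
Variable R : realType.
Local Notation C := (complexNF R).
Implicit Types f g : R -> C.

(** Real and imaginary parts are kept apart so that the real mean value theorem and the fundamental
    theorem of calculus apply. At the end points, continuity is enough. *)
Definition cder f f' := forall t : R, 0 < t < 1 ->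
  is_derive t (1 : R) (fun x => complex.Re (f x) : R) (complex.Re (f' t)) /\
  is_derive t (1 : R) (fun x => complex.Im (f x) : R) (complex.Im (f' t)).

Lemma cder_eq f f' g g' : f =1 g -> (forall x : R, 0 < x < 1 -> f' x = g' x) ->
  cder f f' -> cder g g'.
Proof. by move=> /funext <- f'g' df t tI; have := df t tI; rewrite f'g'. Qed.

Lemma cder_cst (c : C) : cder (fun=> c) (fun=> 0).
Proof. by move=> t _; split; apply: is_derive_cst. Qed.

Lemma cder_real_complex : cder (fun x : R => x%:C) (fun=> 1).
Proof. by move=> t _; split => /=; [apply: is_derive_id|apply: is_derive_cst]. Qed.

Lemma ReD (x y : C) : complex.Re (x + y) = complex.Re x + complex.Re y.
Proof. by case: x y => [a b] [c d]. Qed.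

Lemma ImD (x y : C) : complex.Im (x + y) = complex.Im x + complex.Im y.
Proof. by case: x y => [a b] [c d]. Qed.

Lemma cderD f f' g g' : cder f f' -> cder g g' ->
  cder (fun x => f x + g x) (fun x => f' x + g' x).
Proof.
move=> df dg t tI; have [fr fi] := df t tI; have [gr gi] := dg t tI.
rewrite !ReD !ImD.
split.
  under [X in is_derive _ _ X]eq_fun do rewrite ReD.
  exact: is_deriveD.
under [X in is_derive _ _ X]eq_fun do rewrite ImD.
exact: is_deriveD.
Qed.

Lemma ReM (x y : C) :
  complex.Re (x * y) = complex.Re x * complex.Re y - complex.Im x * complex.Im y.
Proof. by case: x y => [a b] [c d]. Qed.

Lemma ImM (x y : C) :
  complex.Im (x * y) = complex.Re x * complex.Im y + complex.Im x * complex.Re y.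
Proof. by case: x y => [a b] [c d]. Qed.

Lemma cderM f f' g g' : cder f f' -> cder g g' ->
  cder (fun x => f x * g x) (fun x => f' x * g x + f x * g' x).
Proof.
move=> df dg t tI; have [fr fi] := df t tI; have [gr gi] := dg t tI.
split.
  under [X in is_derive _ _ X]eq_fun do rewrite ReM.
  apply: (@is_derive_eq _ _ _ _ _ _ _ _ (is_deriveB (is_deriveM fr gr) (is_deriveM fi gi))).
  rewrite ReD /= !ReM.
  rewrite !/(_ *: _) /=; ring.
under [X in is_derive _ _ X]eq_fun do rewrite ImM.
apply: (@is_derive_eq _ _ _ _ _ _ _ _ (is_deriveD (is_deriveM fr gi) (is_deriveM fi gr))).
rewrite ImD /= !ImM.
rewrite !/(_ *: _) /=; ring.
Qed.

Lemma cder_sum (I : Type) (s : seq I) (P : pred I) (f f' : I -> R -> C) :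
  (forall i, P i -> cder (f i) (f' i)) ->
  cder (fun x => \sum_(i <- s | P i) f i x) (fun x => \sum_(i <- s | P i) f' i x).
Proof.
move=> df; elim: s => [|i s IH].
  by apply: (cder_eq _ _ (@cder_cst 0)) => x; rewrite big_nil.
case: (boolP (P i)) => Pi.
  by apply: (cder_eq _ _ (cderD (df i Pi) IH)) => x; rewrite big_cons Pi.
by apply: (cder_eq _ _ IH) => x; rewrite big_cons (negPf Pi).
Qed.

Lemma MVT01_bound (f f' : R -> R) (e x : R) : cont01 f -> 0 <= x <= 1 ->
  (forall t : R, 0 < t < 1 -> is_derive t (1 : R) f (f' t)) ->
  (forall t : R, 0 < t < 1 -> `|f' t| <= e) -> `|f x - f 0| <= e * x.
Proof.
move=> cf /andP[]; rewrite le_eqVlt => /predU1P[<- _ _ _|x0 x1 df fe].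
  by rewrite subrr normr0 mulr0.
have tI t : t \in `]0, x[ -> 0 < t < 1.
  by rewrite in_itv /= => /andP[-> /lt_le_trans]; exact.
have cfx : {within `[0%R, x], continuous f}.
  by apply: continuous_subspaceW cf; apply: subset_itvl; rewrite bnd_simp.
have [t /tI t01 ->] := MVT x0 (fun t tx => df t (tI t tx)) cfx.
by rewrite subr0 normrM (gtr0_norm x0) ler_wpM2r ?fe // ltW.
Qed.

(** There is no mean value equality for complex values, but the bound that it gives holds for the
    real and the imaginary part separately. *)
Lemma cder_bound f f' (e : R) : cont01 f -> cder f f' ->
  (forall t : R, 0 < t < 1 -> `|complex.Re (f' t)| <= e /\ `|complex.Im (f' t)| <= e) ->
  `|complex.Re (f 1) - complex.Re (f 0)| <= e /\
  `|complex.Im (f 1) - complex.Im (f 0)| <= e.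
Proof.
move=> cf df fe; rewrite -(mulr1 e); split.
  apply: (MVT01_bound (f' := fun t => complex.Re (f' t)) (cont01_Re cf)).
  - by rewrite ler01 lexx.
  - by move=> t tI; have [] := df t tI.
  - by move=> t tI; have [] := fe t tI.
apply: (MVT01_bound (f' := fun t => complex.Im (f' t)) (cont01_Im cf)).
- by rewrite ler01 lexx.
- by move=> t tI; have [] := df t tI.
- by move=> t tI; have [] := fe t tI.
Qed.

Lemma is_derive0_cst01 (f : R -> R) : cont01 f ->
  (forall t : R, 0 < t < 1 -> is_derive t (1 : R) f 0) ->
  forall x : R, 0 <= x <= 1 -> f x = f 0.
Proof.
move=> cf df x xI; apply/eqP; rewrite -subr_eq0 -normr_le0.
have := @MVT01_bound f (fun=> 0) 0 x cf xI df.
by rewrite mul0r; apply => t _; rewrite normr0.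
Qed.

Lemma cder0_cst f f' : cont01 f -> cder f f' -> (forall t : R, 0 < t < 1 -> f' t = 0) ->
  forall x : R, 0 <= x <= 1 -> f x = f 0.
Proof.
move=> cf df f'0 x xI; apply/eqP; rewrite eq_complex; apply/andP; split; apply/eqP.
  apply: (is_derive0_cst01 (cont01_Re cf) _ xI) => t tI.
  by have [] := df t tI; rewrite f'0.
apply: (is_derive0_cst01 (cont01_Im cf) _ xI) => t tI.
by have [] := df t tI; rewrite f'0.
Qed.

Definition mder p q (A A' : R -> 'M[C]_(p, q)) :=
  forall i j, cder (fun x => A x i j) (fun x => A' x i j).

Lemma mder_eq p q (A A' B B' : R -> 'M[C]_(p, q)) :
  A =1 B -> (forall x : R, 0 < x < 1 -> A' x = B' x) -> mder A A' -> mder B B'.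
Proof. by move=> AB AB' dA i j; apply: cder_eq (dA i j) => x *; rewrite ?AB ?AB'. Qed.

Lemma mder_cst p q (A : 'M[C]_(p, q)) : mder (fun=> A) (fun=> 0).
Proof. by move=> i j; apply: cder_eq (@cder_cst (A i j)) => // x _; rewrite mxE. Qed.

Lemma mderD p q (A A' B B' : R -> 'M[C]_(p, q)) : mder A A' -> mder B B' ->
  mder (fun x => A x + B x) (fun x => A' x + B' x).
Proof. by move=> dA dB i j; apply: cder_eq (cderD (dA i j) (dB i j)) => x *; rewrite mxE. Qed.

Lemma mder_mul p q r (A A' : R -> 'M[C]_(p, q)) (B B' : R -> 'M[C]_(q, r)) :
  mder A A' -> mder B B' ->
  mder (fun x => A x *m B x) (fun x => A' x *m B x + A x *m B' x).
Proof.
move=> dA dB i j.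
apply: (@cder_eq (fun x => \sum_k A x i k * B x k j)
   (fun x => \sum_k (A' x i k * B x k j + A x i k * B' x k j))); last first.
- by apply: cder_sum => k _; apply: cderM.
- by move=> x _; rewrite !mxE big_split.
- by move=> x; rewrite mxE.
Qed.

Lemma mderZ p q (c : C) (A A' : R -> 'M[C]_(p, q)) : mder A A' ->
  mder (fun x => c *: A x) (fun x => c *: A' x).
Proof.
move=> dA i j; apply: cder_eq (cderM (cder_cst c) (dA i j)) => x *; rewrite !mxE //.
by rewrite mul0r add0r.
Qed.

Lemma mderZl p q (f f' : R -> C) (A : 'M[C]_(p, q)) : cder f f' ->
  mder (fun x => f x *: A) (fun x => f' x *: A).
Proof.
move=> df i j; apply: cder_eq (cderM df (cder_cst (A i j))) => x *; rewrite !mxE //.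
by rewrite mulr0 addr0.
Qed.

Lemma mder0_cst p q (A A' : R -> 'M[C]_(p, q)) : mcont01 A -> mder A A' ->
  (forall t : R, 0 < t < 1 -> A' t = 0) -> forall x : R, 0 <= x <= 1 -> A x = A 0.
Proof.
move=> cA dA A'0 x xI; apply/matrixP => i j.
apply: (cder0_cst (cA i j) (dA i j) _ xI) => t tI.
by rewrite A'0 // mxE.
Qed.

Local Notation mu := (@lebesgue_measure R).

(** The primitive is the integral over [[0, t]]: integrability makes it continuous up to the end
    points, and the fundamental theorem of calculus differentiates it at interior points. *)
Lemma primitive01 (f : R -> R) : cont01 f -> exists F : R -> R,
  [/\ cont01 F, F 0 = 0, F 1 = \int[mu]_(x in `[0%R, 1%R]) f x &
    forall t : R, 0 < t < 1 -> is_derive t (1 : R) F (f t)].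
Proof.
move=> cf; have intf := cont01_integrable cf.
exists (fun t => \int[mu]_(x in `[0%R, t]) f x)%R; split => //.
- exact: parameterized_integral_continuous.
- by rewrite set_itv1 Rintegral_set1.
move=> t /andP[t0 t1].
have fct : {for t, continuous f}.
  have /(continuous_within_itvP _ ltr01)[+ _ _] := cf.
  by apply; rewrite in_itv /= t0.
have [dF <-] := continuous_FTC1_closed t1 intf t0 fct.
by rewrite derive1E; apply: derivableP.
Qed.

Lemma mx_primitive01 p q (A : R -> 'M[R[i]]_(p, q)) : mcont01 (A : R -> 'M[C]_(p, q)) ->
  exists L : R -> 'M[R[i]]_(p, q),
  [/\ mcont01 (L : R -> 'M[C]_(p, q)), L 0 = 0, L 1 = mx_integral01 A & mder L A].
Proof.
move=> cA.
(* [pr] stands for the real or the imaginary part; primitives of both are chosen entry by entry. *)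
pose P (pr : R[i] -> R) i j (F : R -> R) :=
  [/\ cont01 F, F 0 = 0, F 1 = \int[mu]_(x in `[0%R, 1%R]) pr (A x i j) &
    forall t : R, 0 < t < 1 -> is_derive t (1 : R) F (pr (A t i j))].
have exP (pr : R[i] -> R) : (forall i j, cont01 (fun x => pr (A x i j))) ->
    exists F : 'I_p -> 'I_q -> R -> R, forall i j, P pr i j (F i j).
  move=> cg; have Pj i j : exists F, P pr i j F by apply: primitive01.
  have Pi i : exists Fi, forall j, P pr i j (Fi j).
    by have [Fi FiP] := choice (Pj i); exists Fi.
  by have [F FP] := choice Pi; exists F.
have [F hF] := exP _ (fun i j => cont01_Re (cA i j)).
have [G hG] := exP _ (fun i j => cont01_Im (cA i j)).
exists (fun t => \matrix_(i, j) (F i j t +i* G i j t)); split.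
- move=> i j; have [cF _ _ _] := hF i j; have [cG _ _ _] := hG i j.
  by apply: cont01_ReIm; [apply: cont01_eq cF|apply: cont01_eq cG] => x _; rewrite mxE.
- apply/matrixP => i j; rewrite !mxE.
  by have [_ -> _ _] := hF i j; have [_ -> _ _] := hG i j.
- apply/matrixP => i j; rewrite !mxE.
  by have [_ _ -> _] := hF i j; have [_ _ -> _] := hG i j.
- move=> i j t tI; have [_ _ _ dF] := hF i j; have [_ _ _ dG] := hG i j.
  split.
    by under [X in is_derive _ _ X]eq_fun do rewrite mxE; apply: dF.
  by under [X in is_derive _ _ X]eq_fun do rewrite mxE; apply: dG.
Qed.

End Derivation.

(** * The matrix exponential *)

Section Exponential.
Variable R : realType.
Local Notation C := (complexNF R).
Local Notation normc := (@Normc.normc R).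

Lemma normc_ge_Re_Im (z : C) : `|complex.Re z| <= normc z /\ `|complex.Im z| <= normc z.
Proof.
case: z => a b /=; rewrite -!sqrtr_sqr !ler_sqrt ?addr_ge0 ?sqr_ge0 //.
by rewrite lerDl lerDr !sqr_ge0.
Qed.

Lemma normc_le_ReIm (z : C) : normc z <= `|complex.Re z| + `|complex.Im z|.
Proof.
case: z => a b /=; rewrite -(@ger0_norm _ (`|a| + `|b|)) ?addr_ge0 // -sqrtr_sqr.
rewrite ler_sqrt ?sqr_ge0 // sqrrD !real_normK ?num_real // -addrA lerD2l lerDr.
by rewrite mulrn_wge0 // mulr_ge0.
Qed.

Lemma normc_ge0 (z : C) : 0 <= normc z.
Proof. by case: z => a b; apply: sqrtr_ge0. Qed.

Lemma normc_sum (I : Type) (s : seq I) (f : I -> C) :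
  normc (\sum_(i <- s) f i) <= \sum_(i <- s) normc (f i).
Proof.
elim: s => [|i s IH]; first by rewrite !big_nil Normc.normc0.
by rewrite !big_cons (le_trans (le_normcD _ _)) // lerD2l.
Qed.

(** The entrywise maximum is not submultiplicative: in [mbound_mul], a product costs a factor equal
    to the inner dimension. *)
Definition mbound p q (A : 'M[C]_(p, q)) (c : R) := forall i j, normc (A i j) <= c.

Lemma mbound_mul p q r (A : 'M[C]_(p, q)) (B : 'M[C]_(q, r)) (a b : R) :
  mbound A a -> mbound B b -> mbound (A *m B) (q%:R * (a * b)).
Proof.
move=> bA bB i j; rewrite mxE (le_trans (normc_sum _ _)) //.
have -> : q%:R * (a * b) = \sum_(k < q) a * b by rewrite sumr_const card_ord mulr_natl.
by apply: ler_sum => k _; rewrite Normc.normcM ler_pM ?bA ?bB ?normc_ge0.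
Qed.

Lemma mcont01_bounded p q (A : R -> 'M[C]_(p, q)) : mcont01 A ->
  exists2 c : R, 0 <= c & forall x, 0 <= x <= 1 -> mbound (A x) c.
Proof.
move=> cA.
have /choice[c cP] : forall i : 'I_p * 'I_q, exists c : R,
    0 <= c /\ forall x, 0 <= x <= 1 -> normc (A x i.1 i.2) <= c.
  move=> [i j] /=; have [a a0 Aa] := cont01_bounded (cont01_Re (cA i j)).
  have [b b0 Ab] := cont01_bounded (cont01_Im (cA i j)).
  exists (a + b); split; first by rewrite addr_ge0.
  by move=> x xI; rewrite (le_trans (normc_le_ReIm _)) // lerD ?Aa ?Ab.
exists (\sum_i c i); first by rewrite sumr_ge0 // => i _; case: (cP i).
move=> x xI i j; have [_ /(_ x xI) /le_trans] := cP (i, j); apply.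
by rewrite (bigD1 (i, j)) //= lerDl sumr_ge0 // => k _; case: (cP k).
Qed.

(** These are the partial sums in [is_mxexp]; with [N] terms, they stop at degree [N - 1]. *)
Definition exp_sum (K : numFieldType) D (N : nat) (L : 'M[K]_D) : 'M[K]_D :=
  \sum_(k < N) (k`!%:R)^-1 *: L ^+ k.

Lemma exp_sumS (K : numFieldType) D N (L : 'M[K]_D) :
  exp_sum N.+1 L = exp_sum N L + (N`!%:R)^-1 *: L ^+ N.
Proof. by rewrite /exp_sum big_ord_recr. Qed.

Lemma exp_sum0 (K : numFieldType) D N : exp_sum N.+1 (0 : 'M[K]_D) = 1%:M.
Proof.
rewrite /exp_sum big_ord_recl /= expr0 fact0 invr1 scale1r big1 ?addr0 // => i _.
by rewrite exprS mul0r scaler0.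
Qed.

Lemma comm_exp_sum (K : numFieldType) D N (L A : 'M[K]_D) : A *m L = L *m A ->
  A *m exp_sum N L = exp_sum N L *m A.
Proof.
move=> AL; rewrite /exp_sum mulmx_sumr mulmx_suml; apply: eq_bigr => k _.
by rewrite -scalemxAr -scalemxAl; congr (_ *: _); apply: (@commrX 'M[K]_D).
Qed.

(** Since [Z t] commutes with its derivative, powers are differentiated as for scalars, and
    differentiating the exponential sum drops its last term. *)
Lemma mder_exp_sum D (Z K : R -> 'M[C]_D) N :
  (forall t : R, 0 < t < 1 -> Z t *m K t = K t *m Z t) ->
  mder Z (fun t => - K t) ->
  mder (fun t => exp_sum N.+1 (Z t)) (fun t => - (K t *m exp_sum N (Z t))).
Proof.
move=> ZK dZ.
have dX k : mder (fun t => Z t ^+ k.+1) (fun t => - (k.+1%:R *: (K t *m Z t ^+ k))).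
  elim: k => [|k IH].
    by apply: mder_eq dZ => [t|t tI]; rewrite ?expr1 // expr0 scale1r mulmx1.
  apply: mder_eq (mder_mul dZ IH) => [t|t tI]; first by rewrite [RHS]exprS.
  rewrite mulNmx mulmxN -scalemxAr mulmxA ZK // -mulmxA -[Z t *m _]exprS -opprD.
  by congr (- _); rewrite -[k.+2%:R]natr1 scalerDl scale1r addrC.
elim: N => [|N IH].
  apply: mder_eq (mder_cst 1%:M) => [t|t tI]; last by rewrite /exp_sum big_ord0 mulmx0 oppr0.
  by rewrite /exp_sum big_ord1 expr0 fact0 invr1 scale1r.
apply: mder_eq (mderD IH (mderZ ((N.+1)`!%:R^-1) (dX N))) => [t|t tI].
  by rewrite [RHS]exp_sumS.
rewrite (exp_sumS N) mulmxDr opprD; congr (_ + _).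
rewrite scalerN scalerA -scalemxAr; congr (- (_ *: _)).
by rewrite factS natrM invfM mulrAC mulVf ?mul1r ?pnatr_eq0.
Qed.

Lemma mcont01X D (Z : R -> 'M[C]_D) k : mcont01 Z -> mcont01 (fun t => Z t ^+ k).
Proof.
move=> cZ; elim: k => [|k IH]; first exact: mcont01_cst.
by move=> i j; under eq_fun do rewrite exprS; apply: mcont01_mul.
Qed.

Lemma mcont01_exp_sum D (Z : R -> 'M[C]_D) N :
  mcont01 Z -> mcont01 (fun t => exp_sum N (Z t)).
Proof.
move=> cZ; apply: mcont01_sum => k _; apply: mcont01Z; first exact: cont01_cst.
exact: mcont01X.
Qed.

Lemma mbound_exp D (Z : 'M[C]_D) c k : mbound Z c -> mbound (Z ^+ k) ((D%:R * c) ^+ k).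
Proof.
move=> bZ; elim: k => [|k IH].
  move=> i j; rewrite !expr0 mxE; case: (i == j); rewrite ?Normc.normc0 ?Normc.normc1 //.
by rewrite !exprS -mulrA; apply: mbound_mul.
Qed.

Lemma cvg_dominated (u e : nat -> R) (l : R) :
  (forall n, `|l - u n| <= e n) -> e @ \oo --> 0 -> u @ \oo --> l.
Proof.
move=> ue e0; apply/cvgrPdist_lt => d d0; near=> n.
apply: le_lt_trans (ue n) _; apply: le_lt_trans (ler_norm _) _.
by rewrite -[e n]opprK normrN -[- e n]sub0r; near: n; apply: cvgr_dist_lt.
Unshelve. all: by end_near. Qed.

(* Along [G' = K G], the derivative of [exp_sum N.+1 (L 1 - L t) *m G t]
   collapses to the single term [K (L 1 - L t)^N / N! G], which tends to 0
   uniformly. *)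
Lemma mxexp_ode D (L K G : R -> 'M[C]_D) :
  mcont01 L -> mcont01 K -> mcont01 G ->
  mder L K -> mder G (fun t => K t *m G t) ->
  (forall t : R, 0 < t < 1 -> (L 1 - L t) *m K t = K t *m (L 1 - L t)) ->
  L 0 = 0 -> G 0 = 1%:M -> is_mxexp (L 1) (G 1).
Proof.
move=> cL cK cG dL dG ZK L0 G0.
pose Z t := L 1 - L t.
have cZ : mcont01 Z := mcont01B (@mcont01_cst R C D D (L 1)) cL.
have dZ : mder Z (fun t => - K t).
  apply: mder_eq (mderD (mder_cst (L 1)) (mderZ (-1) dL)) => [t|t _].
    by rewrite scaleN1r.
  by rewrite scaleN1r add0r.
have [a a0 Ka] := mcont01_bounded cK; have [b b0 Zb] := mcont01_bounded cZ.
have [c c0 Gc] := mcont01_bounded cG.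
pose f N t := exp_sum N.+1 (Z t) *m G t.
have df N : mder (f N) (fun t => (N`!%:R)^-1 *: (K t *m Z t ^+ N *m G t)).
  apply: mder_eq (mder_mul (mder_exp_sum N ZK dZ) dG) => [//|t tI].
  rewrite !mulmxA -(comm_exp_sum (N.+1) (esym (ZK t tI))) -mulmxDl exp_sumS mulmxDr addKr.
  by rewrite -scalemxAr -scalemxAl.
have cf N : mcont01 (f N) := mcont01_mul (@mcont01_exp_sum D Z N.+1 cZ) cG.
(* The entries of [K], [Z] and [G] are bounded by [a], [b] and [c]; each matrix product brings a
   factor [D], and the factorial makes [e] tend to 0. *)
pose e N := (D%:R * (D%:R * a * c)) * exp_coeff (D%:R * b) N.
have e0 : e @ \oo --> 0.
  rewrite -[0](mulr0 (D%:R * (D%:R * a * c))).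
  by apply: cvgM; [apply: cvg_cst|apply: cvg_exp_coeff].
have fe N i j (t : R) : 0 < t < 1 ->
    normc (((N`!%:R)^-1 *: (K t *m Z t ^+ N *m G t)) i j) <= e N.
  move=> /andP[t0 t1]; have tI : 0 <= t <= 1 by rewrite !ltW.
  rewrite mxE Normc.normcM Normc.normcV.
  have -> : normc N`!%:R = N`!%:R.
    by rewrite -(rmorph_nat (real_complex R)) /= expr0n addr0 sqrtr_sqr ger0_norm.
  have := mbound_mul (mbound_mul (Ka t tI) (@mbound_exp _ _ _ N (Zb t tI))) (Gc t tI) i j.
  move=> /(ler_wpM2l (_ : 0 <= (N`!%:R)^-1 :> R)) => h.
  apply: le_trans (h _) _; first by rewrite invr_ge0.
  by rewrite /e /exp_coeff /= le_eqVlt; apply/orP; left; apply/eqP; ring.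
have fe' N i j (t : R) : 0 < t < 1 ->
    `|complex.Re (((N`!%:R)^-1 *: (K t *m Z t ^+ N *m G t)) i j)| <= e N /\
    `|complex.Im (((N`!%:R)^-1 *: (K t *m Z t ^+ N *m G t)) i j)| <= e N.
  move=> tI; have [/le_trans h1 /le_trans h2] :=
    normc_ge_Re_Im (((N`!%:R)^-1 *: (K t *m Z t ^+ N *m G t)) i j).
  by split; [apply: h1|apply: h2]; apply: fe.
(* [f N 0] is a partial sum of the exponential of [L 1], because [L 0 = 0] and [G 0 = 1], whereas
   [f N 1] is [G 1] for every [N]. The mean value bound makes their difference at most [e N]. *)
suff cv i j : (fun N => f N 0 i j) @ \oo --> (G 1 i j : C).
  apply: mx_cvgP => i j; rewrite -cvg_shiftS /=.
  rewrite (_ : (fun x => _) = (fun N => f N 0 i j)) //.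
  by apply/funext => N; rewrite /f G0 mulmx1 /Z L0 subr0.
have f1 N : f N 1 = G 1 by rewrite /f /Z subrr exp_sum0 mul1mx.
apply: cvg_ReIm.
  apply: cvg_dominated e0 => N; rewrite -[in X in `|X|](f1 N).
  by have [] := cder_bound (cf N i j) (df N i j) (@fe' N i j).
apply: cvg_dominated e0 => N; rewrite -[in X in `|X|](f1 N).
by have [] := cder_bound (cf N i j) (df N i j) (@fe' N i j).
Qed.
End Exponential.

(** * Commuting matrices, eigenvectors and limits of exponential sums *)

Lemma common_eigenvector_sub (F : numClosedFieldType) D (A B W : 'M[F]_D) :
  W != 0 -> A *m B = B *m A -> (W *m A <= W)%MS -> (W *m B <= W)%MS ->
  exists u : 'rV_D, exists a b,
    [/\ u *m W != 0, u *m W *m A = a *: (u *m W) & u *m W *m B = b *: (u *m W)].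
Proof.
move=> W0 AB sA sB.
have W_gt0 : (0 < \rank W)%N by rewrite lt0n mxrank_eq0.
(* The restrictions to the row space of [W] still commute, so they have a common eigenvector, which
   [row_base W] carries back. Its preimage [u] under [W] is kept: uniqueness of the logarithm uses
   [u] as a generalised eigenvector. *)
have [||v v0 /andP[vA vB]] := @common_eigenvector2 _ _ (restrictmx W A) (restrictmx W B) => //.
  by rewrite -!conjmxM ?inE ?stablemx_row_base // AB.
rewrite stablemx_restrict // in vA; rewrite stablemx_restrict // in vB.
have /submxP[u uE] : (v *m row_base W <= W)%MS.
  by rewrite (submx_trans (submxMl _ _)) // eq_row_base.
move: vA vB => /sub_rVP[a va] /sub_rVP[b vb].
by exists u, a, b; rewrite -uE; split => //; rewrite mulmx_free_eq0 ?row_base_free.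
Qed.

Section Limits.
Variable K : numFieldType.

(** Each entry of the product is a finite sum of multiples of entries of [u n]. With [1%:M] as one
    of the factors, this covers multiplication on a single side. *)
Lemma cvg_mulmx_coord D p q (A : 'M[K]_(p, D)) (B : 'M[K]_(D, q))
    (u : nat -> 'M[K]_D) (l : 'M[K]_D) :
  u @ \oo --> l -> forall i j, (A *m u n *m B) i j @[n --> \oo] --> (A *m l *m B) i j.
Proof.
move=> ul i j.
have E (X : 'M[K]_D) : (A *m X *m B) i j = \sum_k (\sum_h A i h * X h k) * B k j.
  by rewrite mxE; apply: eq_bigr => k _; rewrite mxE.
rewrite E; under eq_fun do rewrite E.
have cu h k : u n h k @[n --> \oo] --> l h k.
  exact: (cvg_comp _ _ ul (@coord_continuous _ _ _ h k l)).
have cs n (f : 'I_n -> nat -> K) (a : 'I_n -> K) : (forall k, f k n @[n --> \oo] --> a k) ->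
    (\sum_k f k n @[n --> \oo] --> \sum_k a k).
  elim: n f a => [|n IH] f a fa.
    by rewrite big_ord0; under eq_fun do rewrite big_ord0; apply: cvg_cst.
  rewrite big_ord_recl; under eq_fun do rewrite big_ord_recl.
  exact: cvgD (fa _) (IH _ _ (fun k => fa (lift ord0 k))).
apply: (cs D) => k; apply: cvgM; last exact: cvg_cst.
by apply: (cs D) => h; apply: cvgM; [exact: cvg_cst|exact: cu].
Qed.

Lemma is_mxexp_comm D (L M : 'M[K]_D) : is_mxexp L M -> L *m M = M *m L.
Proof.
move=> LM; apply/matrixP => i j.
have h1 : (L *m exp_sum N L *m 1%:M) i j @[N --> \oo] --> (L *m M *m 1%:M) i j.
  exact: cvg_mulmx_coord.
have h2 : (1%:M *m exp_sum N L *m L) i j @[N --> \oo] --> (1%:M *m M *m L) i j.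
  exact: cvg_mulmx_coord.
rewrite mulmx1 in h1; rewrite mul1mx in h2.
apply: (cvg_unique _ h1); first exact: norm_hausdorff.
rewrite (_ : (fun N => _) = (fun N => (1%:M *m exp_sum N L *m L) i j)) //.
by apply/funext => N; rewrite mulmx1 mul1mx (@comm_exp_sum K D N L L).
Qed.

Definition exp_sumc N (a : K) : K := \sum_(k < N) (k`!%:R)^-1 * a ^+ k.

Lemma eigen_exp_sum D N (L : 'M[K]_D) (v : 'rV_D) a : v *m L = a *: v ->
  v *m exp_sum N L = exp_sumc N a *: v.
Proof.
move=> vL; have vX k : v *m L ^+ k = a ^+ k *: v.
  elim: k => [|k IH]; first by rewrite !expr0 mulmx1 scale1r.
  by rewrite !exprSr mulmxA IH -scalemxAl vL scalerA.
rewrite mulmx_sumr scaler_suml; apply: eq_bigr => k _.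
by rewrite -scalemxAr vX scalerA.
Qed.
End Limits.

(** * The complex exponential and uniqueness of the principal logarithm *)

Section ComplexExponential.
Variable R : realType.
Local Notation C := (complexNF R).

(** Euler's formula reduces non-vanishing and injectivity to facts on real functions; [cvg_exp_sumc]
    identifies it with the exponential series. *)
Definition cexp (z : C) : C :=
  (expR (complex.Re z) * cos (complex.Im z)) +i* (expR (complex.Re z) * sin (complex.Im z)).

Lemma cexp_neq0 z : cexp z != 0.
Proof.
rewrite eq_complex /= !mulf_eq0 !(gt_eqF (expR_gt0 _)) /=.
apply/negP => /andP[/eqP c0 /eqP s0].
by have := cos2Dsin2 (complex.Im z); rewrite c0 s0 expr0n addr0 => /esym/eqP; rewrite oner_eq0.
Qed.

(** Equal moduli give equal real parts, equal cosines then give imaginary parts equal up to sign,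
    and the sines settle the sign. *)
Lemma cexp_inj (a b : C) : - pi < complex.Im a < pi -> - pi < complex.Im b < pi ->
  cexp a = cexp b -> a = b.
Proof.
case: a b => [a x] [b y] /= /andP[x1 x2] /andP[y1 y2] [h1 h2].
have ea : a = b.
  apply: expR_inj; apply/eqP; rewrite -(@eqrXn2 _ 2) // ?expR_ge0 //; apply/eqP.
  rewrite -[LHS]mulr1 -(cos2Dsin2 x) -[RHS]mulr1 -(cos2Dsin2 y).
  by rewrite !mulrDr -!exprMn h1 h2.
rewrite -{b}ea in h1 h2 *.
have e0 := lt0r_neq0 (expR_gt0 a).
move: h1 h2 => /(mulfI e0) hc /(mulfI e0) hs.
have nxy : `|x| = `|y|.
  apply: cos_inj; rewrite ?cos_norm // in_itv /= normr_ge0 ltW // ltr_norml ?x1 ?y1 //.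
congr (_ +i* _); move/eqP: nxy; rewrite eqr_norm2 => /orP[/eqP //|/eqP xy].
(* Opposite imaginary parts force [sin y = 0], and 0 is the only zero of the sine in
   [(- pi, pi)]. *)
move: hs; rewrite {1}xy sinN => hs; have {hs} sy0 : sin y = 0 by lra.
suff y0 : y = 0 by rewrite xy y0 oppr0.
have [y0|y0|//] := ltgtP y 0.
  by have := @sin_gt0_pi _ (- y); rewrite sinN sy0 oppr0 ltxx oppr_gt0 y0 ltrNl y1 => /(_ isT).
by have := @sin_gt0_pi _ y; rewrite sy0 ltxx y0 y2 => /(_ isT).
Qed.

(** This is [mxexp_ode] in dimension 1, along [t a], whose exponential solves the equation
    [G' = a G]. *)
Lemma is_mxexp_scalar (a : C) : is_mxexp (a%:M : 'M[C]_1) ((cexp a)%:M).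
Proof.
have der (t : R) :
    is_derive t (1 : R) (fun t => complex.Re (cexp (t%:C * a)))
      (complex.Re (a * cexp (t%:C * a))) /\
    is_derive t (1 : R) (fun t => complex.Im (cexp (t%:C * a)))
      (complex.Im (a * cexp (t%:C * a))).
  case: a => a b; rewrite /cexp /=.
  have dl (c : R) : is_derive t (1 : R) (fun t => t * c) c.
    apply: (@is_derive_eq _ _ _ _ _ _ _ _ (is_deriveM (is_derive_id t 1) (is_derive_cst c t 1))).
    by rewrite scaler0 add0r /= /(_ *: _) /= mulr1.
  have de := @is_derive1_comp R expR (fun t => t * a) t _ _ (is_derive_expR (t * a)) (dl a).
  have dc := @is_derive1_comp R cos (fun t => t * b) t _ _ (is_derive_cos (t * b)) (dl b).
  have ds := @is_derive1_comp R sin (fun t => t * b) t _ _ (is_derive_sin (t * b)) (dl b).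
  split.
    under eq_fun do rewrite !mul0r subr0 addr0.
    apply: (@is_derive_eq _ _ _ _ _ _ _ _ (is_deriveM de dc)).
    by rewrite !mul0r subr0 addr0 /= !/(_ *: _) /=; ring.
  under eq_fun do rewrite !mul0r subr0 addr0.
  apply: (@is_derive_eq _ _ _ _ _ _ _ _ (is_deriveM de ds)).
  by rewrite !mul0r subr0 addr0 /= !/(_ *: _) /=; ring.
have cG : mcont01 (fun t : R => (cexp (t%:C * a))%:M : 'M[C]_1).
  move=> i j; rewrite !ord1; under eq_fun do rewrite mxE eqxx mulr1n.
  by apply: cont01_ReIm; apply: derivable_within_continuous => t _; have [[] + _ [] + _] := der t.
have dl : mder (fun t : R => t%:C *: (a%:M : 'M[C]_1)) (fun=> a%:M).
  by apply: mder_eq (mderZl a%:M (@cder_real_complex R)) => // t _; rewrite scale1r.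
have cL : mcont01 (fun t : R => t%:C *: (a%:M : 'M[C]_1)).
  exact: mcont01Z (@cont01_real_complex R) (@mcont01_cst R C 1 1 a%:M).
have dG : mder (fun t : R => (cexp (t%:C * a))%:M : 'M[C]_1)
    (fun t => a%:M *m (cexp (t%:C * a))%:M).
  move=> i j; rewrite !ord1.
  apply: cder_eq (_ : cder (fun t : R => cexp (t%:C * a)) (fun t => a * cexp (t%:C * a))).
  - by move=> t; rewrite mxE eqxx mulr1n.
  - by move=> t _; rewrite -scalar_mxM mxE eqxx mulr1n.
  - by move=> t _; apply: der.
have := @mxexp_ode R 1 _ _ _ cL (@mcont01_cst R C 1 1 a%:M) cG dl dG.
rewrite scale1r mul1r; apply.
- by move=> t _; rewrite scalar_mxC.
- by rewrite scale0r.
- by rewrite mul0r /cexp /= expR0 cos0 sin0 mulr1 mulr0.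
Qed.

Lemma cvg_exp_sumc (a : C) : exp_sumc N a @[N --> \oo] --> cexp a.
Proof.
have h : (1%:M *m exp_sum N (a%:M : 'M[C]_1) *m 1%:M) 0 0 @[N --> \oo] -->
    (1%:M *m (cexp a)%:M *m 1%:M : 'M[C]_1) 0 0.
  by apply: cvg_mulmx_coord; apply: is_mxexp_scalar.
rewrite mulmx1 mul1mx mxE eqxx mulr1n in h.
rewrite (_ : (fun N => _) = (fun N => (1%:M *m exp_sum N (a%:M : 'M[C]_1) *m 1%:M) 0 0)) //.
apply/funext => N; rewrite mulmx1 (@eigen_exp_sum C 1 N a%:M 1%:M a).
  by rewrite !mxE eqxx mulr1.
by rewrite mul1mx scalemx1.
Qed.

Lemma is_mxexp_eigen D (L M : 'M[C]_D) (v : 'rV_D) a : is_mxexp L M -> v *m L = a *: v ->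
  v *m M = cexp a *: v.
Proof.
move=> LM va; apply/rowP => j.
have h : (v *m exp_sum N L *m 1%:M) 0 j @[N --> \oo] --> (v *m M *m 1%:M) 0 j.
  exact: cvg_mulmx_coord.
rewrite mulmx1 in h; apply: (cvg_unique _ h); first exact: norm_hausdorff.
rewrite (_ : (fun N => _) = (fun N => exp_sumc N a * v 0 j)); last first.
  by apply/funext => N; rewrite mulmx1 (eigen_exp_sum _ va) mxE.
rewrite mxE; apply: cvgM; [exact: cvg_exp_sumc|exact: cvg_cst].
Qed.

(** Telescoping [L ^+ k.+1 - L' ^+ k.+1] against [u] gives [k.+1] times [a ^+ k *: w], the
    derivative of a power at [a]. The exponential series being its own derivative, the sum of [N.+1]
    terms yields [exp_sumc N a]. *)
Lemma exp_sum_double_eigen (K : numFieldType) D N (L L' : 'M[K]_D) (u w : 'rV_D) a :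
  L *m L' = L' *m L -> w = u *m (L - L') -> w *m L = a *: w -> w *m L' = a *: w ->
  u *m exp_sum N.+1 L - u *m exp_sum N.+1 L' = exp_sumc N a *: w.
Proof.
move=> LL' wE wL wL'.
have wX k : w *m L' ^+ k = a ^+ k *: w.
  elim: k => [|k IH]; first by rewrite !expr0 mulmx1 scale1r.
  by rewrite !exprSr mulmxA IH -scalemxAl wL' scalerA.
have X k : u *m (L ^+ k.+1 - L' ^+ k.+1) = (k.+1%:R * a ^+ k) *: w.
  elim: k => [|k IH]; first by rewrite !expr1 mul1r scale1r wE.
  have -> : L ^+ k.+2 - L' ^+ k.+2 = (L ^+ k.+1 - L' ^+ k.+1) *m L + (L - L') *m L' ^+ k.+1.
    rewrite !mulmxBl -[L ^+ k.+1 *m L]exprSr -[L' *m _]exprS.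
    have -> : L' ^+ k.+1 *m L = L *m L' ^+ k.+1.
      exact/esym/(@commrX 'M[K]_D).
    by rewrite addrA subrK.
  rewrite mulmxDr !mulmxA IH -wE wX -scalemxAl wL scalerA -scalerDl.
  by congr (_ *: _); rewrite -[k.+2%:R]natr1 mulrDl mul1r exprSr mulrA.
rewrite -mulmxBr /exp_sum -sumrB mulmx_sumr big_ord_recl expr0 subrr mulmx0 add0r.
rewrite scaler_suml; apply: eq_bigr => k _.
rewrite -scalerBr -scalemxAr X scalerA; congr (_ *: _).
rewrite mulrA lift0; congr (_ * _).
by rewrite factS natrM invfM mulrAC mulVf ?mul1r ?pnatr_eq0.
Qed.

(** [complexNF R] is only a [numFieldType]; the closed field structure comes from [R[i]]. *)
Lemma common_eigenvector_subC D (A B W : 'M[C]_D) :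
  W != 0 -> A *m B = B *m A -> (W *m A <= W)%MS -> (W *m B <= W)%MS ->
  exists u : 'rV[C]_D, exists a b : C,
    [/\ u *m W != 0, u *m W *m A = a *: (u *m W) & u *m W *m B = b *: (u *m W)].
Proof. exact: (@common_eigenvector_sub R[i]). Qed.

Lemma principal_log_unique D (M L L' : 'M[C]_D) : is_principal_log M L ->
  is_principal_log M L' -> L *m L' = L' *m L -> L = L'.
Proof.
move=> [LM Ls] [LM' Ls'] LL'; apply/eqP; rewrite -subr_eq0; apply/negPn/negP => Z0.
have [||u [a [b [w0 wL wL']]]] := common_eigenvector_subC Z0 LL'.
- by rewrite mulmxBl -LL' -mulmxBr submxMl.
- by rewrite mulmxBl LL' -mulmxBr submxMl.
have [w wE] : exists w, w = u *m (L - L') by eexists.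
rewrite -wE in w0 wL wL'.
have ab : a = b.
  apply: cexp_inj.
  - by apply: Ls; apply/eigenvalueP; exists w.
  - by apply: Ls'; apply/eigenvalueP; exists w.
  have := is_mxexp_eigen LM wL; rewrite (is_mxexp_eigen LM' wL') => /eqP.
  by rewrite -subr_eq0 -scalerBl scaler_eq0 (negPf w0) orbF subr_eq0 => /eqP.
rewrite -{b}ab in wL'.
case/negP: w0; apply/eqP/rowP => j; apply/eqP; rewrite [X in _ == X]mxE.
have h1 : (u *m exp_sum N L *m 1%:M) 0 j @[N --> \oo] --> (u *m M *m 1%:M) 0 j.
  exact: (cvg_mulmx_coord (LM : @is_mxexp C D L M)).
have h2 : (u *m exp_sum N L' *m 1%:M) 0 j @[N --> \oo] --> (u *m M *m 1%:M) 0 j.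
  exact: (cvg_mulmx_coord (LM' : @is_mxexp C D L' M)).
have coordB (X X' : 'M[C]_D) (c : C) : u *m X - u *m X' = c *: w ->
    c * w 0 j = (u *m X *m 1%:M) 0 j - (u *m X' *m 1%:M) 0 j.
  by move=> /rowP/(_ j); rewrite !mulmx1 [RHS]mxE => <-; rewrite mxE [X in _ + X]mxE.
have E N := coordB _ _ _ (exp_sum_double_eigen N LL' wE wL wL').
(* One sequence has two limits: 0, because [L] and [L'] have the same exponential [M], and
   [cexp a * w 0 j]. As [cexp a] is nonzero, [w] vanishes. *)
have h : exp_sumc N a * w 0 j @[N --> \oo] --> (0 : C).
  rewrite -(subrr ((u *m M *m 1%:M) 0 j)) (funext E).
  rewrite -cvg_shiftS in h1; rewrite -cvg_shiftS in h2.
  exact: cvgB h1 h2.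
have h' : exp_sumc N a * w 0 j @[N --> \oo] --> cexp a * w 0 j.
  by apply: cvgM; [exact: cvg_exp_sumc|exact: cvg_cst].
have /eqP : cexp a * w 0 j = 0 by apply: (cvg_unique _ h' h); exact: norm_hausdorff.
by rewrite mulf_eq0 (negPf (cexp_neq0 _)).
Qed.

End ComplexExponential.

(** * The logarithm as an integral *)

Section LogIntegral.
Variables (R : realType) (D : nat).
Local Notation C := (complexNF R).
Variable M : 'M[C]_D.
Hypothesis M_spec : forall r : R, r <= 0 -> ~~ eigenvalue M (r%:C : C).

(** This is [A x] of the overview, the segment from the identity to [M]. *)
Definition pencil (x : R) : 'M[C]_D := 1%:M - x%:C *: (1%:M - M).

Lemma pencil0 : pencil 0 = 1%:M.
Proof. by rewrite /pencil scale0r subr0. Qed.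

(** A null vector of the pencil at [x > 0] is an eigenvector of [M] for [1 - x^-1], which is at most
    0 when [x <= 1]. *)
Lemma pencil_unit x : 0 <= x <= 1 -> pencil x \in unitmx.
Proof.
move=> /andP[x0 x1]; rewrite unitmxE unitfE; apply/negP => /det0P[v v0 vA].
have {x0} x0 : 0 < x.
  rewrite lt_def x0 andbT; apply: contraNneq v0 => x00.
  by rewrite -vA x00 pencil0 mulmx1.
have r0 : 1 - x^-1 <= 0 by rewrite subr_le0 invf_ge1.
have /negP := M_spec r0; apply; apply/eigenvalueP; exists v => //.
have xC : x%:C != 0 :> C by rewrite (fmorph_eq0 (real_complex R)) gt_eqF.
move: vA; rewrite /pencil mulmxBr mulmx1 -scalemxAr mulmxBr mulmx1 scalerBr.
move=> /eqP; rewrite subr_eq0 => /eqP vE.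
apply: (scalerI xC); rewrite scalerA.
have -> : x%:C * (1 - x^-1)%:C = x%:C - 1 :> C.
  by rewrite -rmorphM mulrBr mulr1 divff ?gt_eqF // rmorphB.
by rewrite scalerBl scale1r [X in _ = _ - X]vE opprB addrC subrK.
Qed.

Definition log_kernel (x : R) : 'M[C]_D := (M - 1%:M) *m invmx (pencil x).

Lemma mcont01_pencil : mcont01 pencil.
Proof.
apply: mcont01B; first exact: mcont01_cst.
by apply: mcont01Z; [exact: cont01_real_complex|exact: mcont01_cst].
Qed.

Lemma mcont01_log_kernel : mcont01 log_kernel.
Proof.
apply: mcont01_mul; first exact: mcont01_cst.
by apply: mcont01_inv; [exact: pencil_unit|exact: mcont01_pencil].
Qed.

Lemma log_kernel_comm (B : 'M[C]_D) x : 0 <= x <= 1 -> B *m M = M *m B ->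
  B *m log_kernel x = log_kernel x *m B.
Proof.
move=> xI BM.
have BA : B *m pencil x = pencil x *m B.
  by rewrite /pencil mulmxBr mulmxBl -scalemxAr -scalemxAl mulmxBr mulmxBl mulmx1 mul1mx BM.
have BV : B *m invmx (pencil x) = invmx (pencil x) *m B.
  rewrite -[LHS](mulKmx (pencil_unit xI)) [X in _ *m X]mulmxA -BA -mulmxA.
  by rewrite mulmxV ?pencil_unit // mulmx1.
rewrite /log_kernel -mulmxA -BV !mulmxA; congr (_ *m _).
by rewrite mulmxBr mulmxBl mulmx1 mul1mx BM.
Qed.

Lemma log_kernel_M x : 0 <= x <= 1 -> log_kernel x *m M = M *m log_kernel x.
Proof. by move=> xI; rewrite log_kernel_comm. Qed.

Lemma pencil_der : mder pencil (fun t => log_kernel t *m pencil t).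
Proof.
apply: mder_eq (mderD (mder_cst 1%:M) (mderZl (M - 1%:M) (@cder_real_complex R)))
  => [t|t /andP[t0 t1]].
  by rewrite /pencil -scalerN opprB.
by rewrite add0r scale1r /log_kernel mulmxKV // pencil_unit // !ltW.
Qed.

(* With [mu = a + i b] and [c = |mu - 1|^2], the imaginary part of the
   derivative of [f] has the primitive [atan ((x c + a - 1) / b)]. *)
Lemma cder_Im_atan (mu : C) (f : R -> C) :
  (forall x, 0 <= x <= 1 -> 1 + x%:C * (mu - 1) != 0) ->
  cont01 f -> cder f (fun x => (mu - 1) / (1 + x%:C * (mu - 1))) -> f 0 = 0 ->
  - pi < complex.Im (f 1) < pi.
Proof.
case: mu => a b nz cf df f0.
have imE (x : R) : complex.Im ((a +i* b - 1) / (1 + x%:C * (a +i* b - 1)) : C) =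
   b / ((1 + x * (a - 1)) ^+ 2 + (x * b) ^+ 2).
  by rewrite ImM /=; simpc => /=; rewrite mulrDr; ring.
(* For real [mu] the arctangent formula would divide by 0, but the imaginary part of [f] is then
   constant. *)
have [b0|b0] := eqVneq b 0.
  have -> : complex.Im (f 1) = complex.Im (f 0).
    apply: (is_derive0_cst01 (cont01_Im cf)); last by rewrite ler01 lexx.
    by move=> t /df[_]; rewrite imE b0 mul0r.
  by rewrite f0 /= oppr_lt0 pi_gt0.
pose c := (a - 1) ^+ 2 + b ^+ 2.
pose g (x : R) := atan ((x * c + (a - 1)) / b).
have dg (x : R) : is_derive x (1 : R) g (b / ((1 + x * (a - 1)) ^+ 2 + (x * b) ^+ 2)).
  have dl : is_derive x (1 : R) (fun x => (x * c + (a - 1)) / b) (c / b).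
    have -> : (fun x => (x * c + (a - 1)) / b) = (c / b) \*: (@id R) + cst ((a - 1) / b).
      apply/funext => y; rewrite /= -[RHS]/(c / b * y + (a - 1) / b); ring.
    apply: (@is_derive_eq _ _ _ _ _ _ _ _
      (is_deriveD (is_deriveZ (c / b) (is_derive_id x 1)) (is_derive_cst _ x 1))).
    by rewrite addr0 /(_ *: _) /= mulr1.
  apply: (@is_derive_eq _ _ _ _ _ _ _ _
    (@is_derive1_comp R atan _ x _ _ (is_derive1_atan _) dl)).
  have c0 : c != 0 by rewrite gt_eqF // ltr_wpDl ?sqr_ge0 // exprn_even_gt0.
  have d0 : (1 + x * (a - 1)) ^+ 2 + (x * b) ^+ 2 != 0.
    have [->|x0] := eqVneq x 0; first by rewrite !mul0r addr0 expr1n expr0n addr0 oner_eq0.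
    by rewrite gt_eqF // ltr_wpDl ?sqr_ge0 // exprn_even_gt0 //= mulf_neq0.
  have e0 : b ^+ 2 + (x * c + (a - 1)) ^+ 2 != 0.
    by rewrite gt_eqF // ltr_pwDl ?sqr_ge0 // exprn_even_gt0.
  (* The factor of [c] on the right is the squared modulus of [1 + x (mu - 1)], the denominator of
     the wanted derivative. *)
  have eE : b ^+ 2 + (x * c + (a - 1)) ^+ 2 = c * ((1 + x * (a - 1)) ^+ 2 + (x * b) ^+ 2).
    by rewrite /c; ring.
  rewrite -[b / _](mulKf c0) mulrCA -[c * (_ / _)]mulrC.
  have -> : (1 + ((x * c + (a - 1)) / b) ^+ 2)^-1 = b ^+ 2 / (b ^+ 2 + (x * c + (a - 1)) ^+ 2).
    by field; rewrite b0 e0.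
  rewrite eE; field.
  by rewrite b0 c0 d0.
have : complex.Im (f 1) - g 1 = complex.Im (f 0) - g 0.
  have cg : cont01 g.
    by apply: derivable_within_continuous => x _; have [] := dg x.
  apply: (@is_derive0_cst01 _ (fun x => complex.Im (f x) - g x)).
  - exact: cont01D (cont01_Im cf) (cont01N cg).
  - move=> x /df[_ dI]; rewrite imE in dI.
    by apply: (@is_derive_eq _ _ _ _ _ _ _ _ (is_deriveB dI (dg x))); rewrite subrr.
  - by rewrite ler01 lexx.
rewrite f0 /= sub0r => /eqP; rewrite subr_eq => /eqP ->.
have h1 := @atan_gtNpi2 R ((1 * c + (a - 1)) / b).
have h2 := @atan_ltpi2 R ((1 * c + (a - 1)) / b).
have h3 := @atan_gtNpi2 R ((0 * c + (a - 1)) / b).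
have h4 := @atan_ltpi2 R ((0 * c + (a - 1)) / b).
by rewrite /g; lra.
Qed.

(** The second part serves uniqueness: any other logarithm of [M] commutes with [M], hence with this
    integral. *)
Lemma log_integral : is_principal_log M (mx_integral01 log_kernel) /\
  forall B : 'M[C]_D, B *m M = M *m B ->
    B *m mx_integral01 log_kernel = mx_integral01 log_kernel *m B.
Proof.
have [L [cL L0 <- dL]] := mx_primitive01 mcont01_log_kernel.
(* The commutator of [B] and [L t] vanishes at 0 and has derivative 0. *)
have Lcomm (B : 'M[C]_D) :
    (forall t : R, 0 < t < 1 -> B *m log_kernel t = log_kernel t *m B) ->
    forall t, 0 <= t <= 1 -> B *m L t = L t *m B.
  move=> BK t tI; apply/eqP; rewrite -subr_eq0; apply/eqP.
  have dB := mder_mul (mder_cst B) dL.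
  have dB' := mderZ (-1) (mder_mul dL (mder_cst B)).
  have cB := mcont01_mul (@mcont01_cst R C D D B) cL.
  have cB' := mcont01_mul cL (@mcont01_cst R C D D B).
  have dZ : mder (fun t => B *m L t - L t *m B) (fun=> 0).
    apply: mder_eq (mderD dB dB') => [s|s sI]; first by rewrite scaleN1r.
    by rewrite mul0mx mulmx0 add0r addr0 BK // scaleN1r subrr.
  by rewrite (mder0_cst (mcont01B cB cB') dZ (fun _ _ => erefl) tI) L0 mulmx0 mul0mx subr0.
have sI : forall t : R, 0 < t < 1 -> 0 <= t <= 1.
  by move=> t /andP[t0 t1]; rewrite !ltW.
have I1 : 0 <= (1 : R) <= 1 by rewrite ler01 lexx.
have LB (B : 'M[C]_D) t : 0 <= t <= 1 -> B *m M = M *m B -> B *m L t = L t *m B.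
  by move=> tI BM; apply: Lcomm tI => s /sI sI'; apply: log_kernel_comm.
have LK (t s : R) : 0 <= t <= 1 -> 0 <= s <= 1 -> L t *m log_kernel s = log_kernel s *m L t.
  by move=> tI sI'; rewrite LB // log_kernel_M.
have LM : is_mxexp (L 1) M.
  have -> : M = pencil 1 by rewrite /pencil scale1r opprB addrC subrK.
  apply: (mxexp_ode cL mcont01_log_kernel mcont01_pencil dL pencil_der _ L0 pencil0).
  by move=> t /sI tI; rewrite mulmxBl mulmxBr !LK.
split; last by move=> B BM; exact: LB I1 BM.
split; first exact: LM.
move=> l l0.
(* The eigenspace of [L 1] for [l] is stable under [M], so it contains an eigenvector of [M], of
   eigenvalue [mu]. Along it, the kernel becomes the scalar function of [cder_Im_atan]. *)
have [||u [mu [b [v0 vM vL]]]] := common_eigenvector_subC l0 (LB M 1 I1 erefl).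
- by apply: comm_mx_stable_eigenspace; apply/esym/(LB M 1 I1).
- by apply: comm_mx_stable_eigenspace.
have [v vE] : exists v, v = u *m eigenspace (L 1) l by eexists.
rewrite -vE in v0 vM vL.
have vl : v *m L 1 = l *: v by apply/eigenspaceP; rewrite vE submxMl.
have [j vj] : exists j, v 0 j != 0.
  apply/existsP; apply: contraR v0; rewrite negb_exists => /forallP v0.
  by apply/eqP/rowP => j; rewrite mxE; apply/eqP; have := v0 j; rewrite negbK.
have vA t : v *m pencil t = (1 + t%:C * (mu - 1)) *: v.
  rewrite /pencil mulmxBr -scalemxAr mulmxBr !mulmx1 vM -{2}[v]scale1r -scalerBl scalerA.
  by rewrite -{1}[v]scale1r -scalerBl; congr (_ *: _); ring.
have nz t : 0 <= t <= 1 -> 1 + t%:C * (mu - 1) != 0.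
  move=> tI; apply: contraNneq v0 => t0; have := vA t; rewrite t0 scale0r.
  by move=> /(congr1 (mulmx^~ (invmx (pencil t)))); rewrite mulmxK ?pencil_unit // mul0mx => ->.
have vK t : 0 <= t <= 1 -> v *m log_kernel t = ((mu - 1) / (1 + t%:C * (mu - 1))) *: v.
  move=> tI; rewrite /log_kernel mulmxA mulmxBr mulmx1 vM -{2}[v]scale1r -scalerBl -scalemxAl.
  rewrite -scalerA; congr (_ *: _); apply: (scalerI (nz t tI)).
  by rewrite scalerA divff ?nz // scale1r scalemxAl -vA mulmxK ?pencil_unit.
(* A nonzero coordinate of [v] expresses [l] as the value at 1 of a scalar primitive. *)
have lE : l = (v 0 j)^-1 * (v *m L 1) 0 j by rewrite vl mxE mulrCA mulVf ?mulr1.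
rewrite lE.
apply: (@cder_Im_atan mu (fun t => (v 0 j)^-1 * (v *m L t) 0 j) nz).
- apply: cont01M; first exact: cont01_cst.
  exact: (mcont01_mul (@mcont01_cst R C 1 D v) cL).
- apply: cder_eq (cderM (@cder_cst R (v 0 j)^-1) (mder_mul (mder_cst v) dL 0 j)) => // t /sI tI.
  by rewrite mul0r add0r mul0mx add0r vK // mxE mulrCA mulVf ?mulr1.
- by rewrite L0 mulmx0 mxE mulr0.
Qed.
End LogIntegral.

(** The integral shows that [xget] picks an actual principal logarithm; that one commutes with its
    exponential [M], so uniqueness applies. *)
Lemma principal_logE (R : realType) D (M : 'M[R[i]]_D) :
  (forall r : R, r <= 0 -> ~~ eigenvalue M r%:C) ->
  principal_log M = mx_integral01 (log_kernel M).
Proof.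
move=> Msp; have [L0M L0B] := @log_integral R D M Msp.
have LM : is_principal_log M (principal_log M).
  apply: (@xgetPex _ 0 [set L | is_principal_log M L]).
  by exists (mx_integral01 (log_kernel M)).
apply: (principal_log_unique LM L0M); apply: L0B.
exact: (@is_mxexp_comm (complexNF R) D _ _ LM.1).
Qed.

(** * Blocks and path sums *)

Section Blocks.
Variables (K : fieldType) (D n : nat) (B : 'I_n -> {set 'I_D}).
Hypothesis B_part : coord_partition B.

Lemma blockE (A : 'M[K]_D) mu nu i j :
  block B A mu nu i j = A (enum_val i) (enum_val j).
Proof.
rewrite /block mxE (bigD1 (enum_val j)) //= [X in _ + X]big1 ?addr0 => [|k kj]; last first.
  by rewrite ![X in _ * X]mxE (negPf kj) mulr0.
rewrite ![X in _ * X]mxE eqxx mulr1 mxE (bigD1 (enum_val i)) //= mxE eqxx mul1r.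
by rewrite big1 ?addr0 // => k ki; rewrite mxE (negPf ki) mul0r.
Qed.

Lemma blockD (A A' : 'M[K]_D) mu nu :
  block B (A + A') mu nu = block B A mu nu + block B A' mu nu.
Proof. by apply/matrixP => i j; rewrite [RHS]mxE !blockE mxE. Qed.

Lemma blockZ c (A : 'M[K]_D) mu nu : block B (c *: A) mu nu = c *: block B A mu nu.
Proof. by apply/matrixP => i j; rewrite [RHS]mxE !blockE mxE. Qed.

Lemma blockN (A : 'M[K]_D) mu nu : block B (- A) mu nu = - block B A mu nu.
Proof. by rewrite -scaleN1r blockZ scaleN1r. Qed.

Lemma blockB (A A' : 'M[K]_D) mu nu :
  block B (A - A') mu nu = block B A mu nu - block B A' mu nu.
Proof. by rewrite blockD blockN. Qed.

Lemma block1 mu : block B (1%:M : 'M[K]_D) mu mu = 1%:M.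
Proof. by apply/matrixP => i j; rewrite blockE !mxE (inj_eq enum_val_inj). Qed.

Lemma mem_block_disjoint mu nu i : i \in B mu -> i \in B nu -> mu = nu.
Proof.
case: B_part => _ dis _ imu inu; apply/eqP; apply/negPn/negP => /dis /setP/(_ i).
by rewrite !inE imu inu.
Qed.

Lemma block1_neq mu nu : mu != nu -> block B (1%:M : 'M[K]_D) mu nu = 0.
Proof.
move=> mn; apply/matrixP => i j; rewrite blockE !mxE.
case: eqP => // ij; case/eqP: mn.
by apply: (@mem_block_disjoint _ _ (enum_val i)); [|rewrite ij]; apply: enum_valP.
Qed.

Lemma sum_blocks (V : zmodType) (f : 'I_D -> V) :
  \sum_i f i = \sum_mu \sum_(k < #|B mu|) f (enum_val k).
Proof.
case: (B_part) => _ _ cov.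
rewrite [RHS](eq_bigr (fun mu => \sum_(i in B mu) f i)) => [|mu _]; last first.
  by symmetry; apply: big_enum_val.
rewrite [RHS](exchange_big_dep predT) //=; apply: eq_bigr => i _.
have [mu imu] := cov i; rewrite (big_pred1 mu) // => nu.
by apply/idP/eqP => [inu|->//]; apply: mem_block_disjoint inu imu.
Qed.

Lemma blockM (A A' : 'M[K]_D) mu nu :
  block B (A *m A') mu nu = \sum_t block B A mu t *m block B A' t nu.
Proof.
apply/matrixP => i j; rewrite blockE mxE sum_blocks summxE; apply: eq_bigr => t _.
by rewrite [RHS]mxE; apply: eq_bigr => k _; rewrite !blockE.
Qed.

End Blocks.

(** * Schur complements of truncated matrices *)

Section Truncation.
Variables (K : fieldType) (D n : nat) (B : 'I_n -> {set 'I_D}).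
Hypothesis B_part : coord_partition B.
Implicit Types (A W : 'M[K]_D) (X Y : {set 'I_n}).

(* The rows and columns of the blocks in [X] are replaced by those of the
   identity, rather than deleted, so that the size does not depend on [X]. *)
Definition truncate A X : 'M[K]_D :=
  \matrix_(i, j) if (i \in \bigcup_(mu in X) B mu)%SET || (j \in \bigcup_(mu in X) B mu)%SET
                 then (i == j)%:R else A i j.

Lemma mem_cover_block X mu (k : 'I_#|B mu|) :
  (enum_val k \in \bigcup_(mu in X) B mu)%SET = (mu \in X).
Proof.
apply/bigcupP/idP => [[nu nuX kn]|muX]; last by exists mu => //; apply: enum_valP.
by rewrite (mem_block_disjoint B_part (enum_valP k) kn).
Qed.

Lemma block_truncate A X mu nu : mu \notin X -> nu \notin X ->
  block B (truncate A X) mu nu = block B A mu nu.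
Proof.
move=> mX nX; apply/matrixP => i j; rewrite !blockE mxE !mem_cover_block.
by rewrite (negPf mX) (negPf nX).
Qed.

Lemma block_truncate0 A X mu nu : mu != nu -> (mu \in X) || (nu \in X) ->
  block B (truncate A X) mu nu = 0.
Proof.
move=> mn mX; rewrite -(block1_neq K B_part mn); apply/matrixP => i j.
by rewrite !blockE !mxE !mem_cover_block mX.
Qed.

Lemma truncate0 A : truncate A finset.set0 = A.
Proof. by apply/matrixP => i j; rewrite mxE big_set0 !inE. Qed.

Variable A : 'M[K]_D.
Hypothesis A_trunc : forall X, truncate A X \in unitmx.

(** Its blocks outside [X] form the inverse of the corresponding principal submatrix of [A]. *)
Definition cinv X := invmx (truncate A X).

Lemma sum_mulmx_cinv X u t : u \notin X ->
  \sum_(v | v \notin X) block B A u v *m block B (cinv X) v t = block B 1%:M u t.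
Proof.
move=> uX; rewrite -(mulmxV (A_trunc X)) (blockM B_part) [RHS](bigID (fun v => v \in X)) /=.
rewrite [X in _ = X + _]big1 ?add0r => [|v vX].
  by apply: eq_bigr => v vX; rewrite block_truncate.
rewrite block_truncate0 ?vX ?orbT ?mul0mx //.
by apply: contraNneq uX => ->.
Qed.

Lemma sum_cinv_mulmx X u t : t \notin X ->
  \sum_(v | v \notin X) block B (cinv X) u v *m block B A v t = block B 1%:M u t.
Proof.
move=> tX; rewrite -(mulVmx (A_trunc X)) (blockM B_part) [RHS](bigID (fun v => v \in X)) /=.
rewrite [X in _ = X + _]big1 ?add0r => [|v vX].
  by apply: eq_bigr => v vX; rewrite block_truncate.
rewrite block_truncate0 ?vX ?mulmx0 //.
by apply: contraNneq tX => <-.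
Qed.

Lemma cinv_offdiag X a v : a \notin X -> v \notin (a |: X)%SET ->
  block B (cinv X) v a =
  - \sum_(u | u \notin (a |: X)%SET)
      block B (cinv (a |: X)) v u *m block B A u a *m block B (cinv X) a a.
Proof.
move=> aX vY; set Y := (a |: X)%SET.
have notY u : (u \notin Y) = (u \notin X) && (u != a) by rewrite !inE negb_or andbC.
apply/eqP; rewrite -addr_eq0; apply/eqP.
(* The rows other than [a] of the linear system for column [a] of [cinv X], multiplied by [cinv Y].
   Isolating the term [t = a] solves for that column. *)
have h : \sum_(u | u \notin Y) block B (cinv Y) v u *m
    (\sum_(t | t \notin X) block B A u t *m block B (cinv X) t a) = 0.
  apply: big1 => u; rewrite notY => /andP[uX ua].
  by rewrite sum_mulmx_cinv // (block1_neq K B_part ua) mulmx0.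
rewrite -[RHS]h.
transitivity (\sum_(u | u \notin Y)
  (block B (cinv Y) v u *m block B A u a *m block B (cinv X) a a +
   \sum_(t | t \notin Y) block B (cinv Y) v u *m block B A u t *m block B (cinv X) t a)); last first.
  apply: eq_bigr => u _; rewrite mulmx_sumr [RHS](bigD1 a) //= mulmxA; congr (_ + _).
  by apply: eq_big => t; rewrite ?notY // mulmxA.
rewrite big_split /= addrC; congr (_ + _).
rewrite exchange_big /=.
transitivity (\sum_(t | t \notin Y) block B 1%:M v t *m block B (cinv X) t a); last first.
  by apply: eq_bigr => t tY; rewrite -mulmx_suml sum_cinv_mulmx.
rewrite (bigD1 v) //= block1 mul1mx big1 ?addr0 // => t /andP[_ tv].
by rewrite (block1_neq K B_part) ?mul0mx // eq_sym.
Qed.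

(** Substituting [cinv_offdiag] into row [a] of the system shows that the Schur complement times the
    block is the identity; hence it is invertible. *)
Lemma cinv_diag X a : a \notin X ->
  block B (cinv X) a a = invmx (block B A a a -
    \sum_(v | v \notin (a |: X)%SET) \sum_(u | u \notin (a |: X)%SET)
       block B A a v *m block B (cinv (a |: X)) v u *m block B A u a).
Proof.
move=> aX; set S := (X in invmx X).
suff h : S *m block B (cinv X) a a = 1%:M.
  have [Su _] := mulmx1_unit h.
  by rewrite -[LHS](mulKmx Su) h mulmx1.
rewrite -(block1 K B a) -(sum_mulmx_cinv a aX) (bigD1 a) //= mulmxBl; congr (_ + _).
rewrite mulmx_suml -sumrN; apply: eq_big => v; first by rewrite !inE negb_or andbC.
move=> vY; rewrite (cinv_offdiag aX vY) mulmxN mulmx_sumr mulmx_suml; congr (- _).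
by apply: eq_bigr => u _; rewrite !mulmxA.
Qed.

End Truncation.

(** * Enumeration of sequences of bounded length *)

Section SeqsUpto.
Variable T : finType.

(** The list is built by first element, so that sums over paths split according to the first
    step. *)
Fixpoint seqs_upto k : seq (seq T) :=
  if k is k'.+1 then [::] :: [seq u :: s | u <- enum T, s <- seqs_upto k'] else [:: [::]].

Lemma mem_seqs_upto k s : (s \in seqs_upto k) = (size s <= k)%N.
Proof.
elim: k s => [|k IH] [|u s] //=; rewrite ?inE ?mem_head //=.
rewrite ltnS -IH; apply/allpairsP/idP => [[[v t] /= [_ tk [_ ->]]] //|sk].
by exists (u, s); rewrite /= mem_enum.
Qed.

Lemma uniq_seqs_upto k : uniq (seqs_upto k).
Proof.
elim: k => //= k IH; rewrite allpairs_uniq ?enum_uniq // ?andbT.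
  by apply/allpairsP => -[[]] u s /= [].
by move=> [u s] [v t] _ _ [-> ->].
Qed.

Lemma big_bseq (V : nmodType) k (P : pred (seq T)) (f : seq T -> V) :
  \sum_(s : k.-bseq T | P s) f s = \sum_(s <- seqs_upto k | P s) f s.
Proof.
rewrite -(big_map (fun s : k.-bseq T => s : seq T) P f).
apply: perm_big; apply: uniq_perm.
- by rewrite map_inj_uniq ?index_enum_uniq //; apply: val_inj.
- exact: uniq_seqs_upto.
move=> s; rewrite mem_seqs_upto; apply/mapP/idP => [[t _ ->]|sk]; first exact: size_bseq.
by exists (Bseq sk); rewrite ?mem_index_enum.
Qed.

Lemma big_seqs_uptoS (V : nmodType) k (P : pred (seq T)) (f : seq T -> V) :
  \sum_(s <- seqs_upto k.+1 | P s) f s =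
  (if P [::] then f [::] else 0) + \sum_u \sum_(s <- seqs_upto k | P (u :: s)) f (u :: s).
Proof.
rewrite /= big_cons big_mkcond big_allpairs_dep big_enum /=.
under [X in _ = _ + X]eq_bigr => u _ do rewrite big_mkcond.
by case: (P [::]); rewrite ?add0r.
Qed.

End SeqsUpto.

Lemma mulmxA4 (K : pzRingType) p q r s t (A : 'M[K]_(p, q)) (B : 'M[K]_(q, r))
    (C : 'M[K]_(r, s)) (D : 'M[K]_(s, t)) : A *m B *m C *m D = A *m (B *m C *m D).
Proof. by rewrite !mulmxA. Qed.

(** * Path sums for the blocks of the inverse *)

Section PathSumInverse.
Variables (K : fieldType) (D n : nat) (B : 'I_n -> {set 'I_D}).
Hypothesis B_part : coord_partition B.
Variables (M : 'M[K]_D) (x : K).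
Implicit Types (X : {set 'I_n}) (a u v w : 'I_n) (s : seq 'I_n).

Let G : rel 'I_n := partition_graph B (1%:M - M).
Let E X := delete_loops (delete_vertices X G).
Let A : 'M[K]_D := 1%:M - x *: (1%:M - M).
Hypothesis A_trunc : forall X, truncate B A X \in unitmx.
(** The closed form of [pathsum_F], as [pathsum_F_cinv] shows. *)
Let W X a := block B (cinv B A X) a a.

Lemma ltn_card_setCU1 X a : a \notin X -> (#|~: (a |: X)%SET| < #|~: X|)%N.
Proof.
move=> aX; apply: proper_card; rewrite finset.properC.
by apply/fintype.properP; split; [exact: finset.subsetUr|exists a; rewrite ?finset.setU11].
Qed.

Lemma card_setCU1 X a k : a \notin X -> (#|~: X| <= k.+1)%N -> (#|~: (a |: X)%SET| <= k)%N.
Proof. by move=> aX Xk; rewrite -ltnS (leq_trans (ltn_card_setCU1 aX)). Qed.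

Lemma edgeE X u v : E X u v = [&& G u v, u \notin X, v \notin X & u != v].
Proof. by rewrite /E /delete_loops /delete_vertices -!andbA. Qed.

Lemma block_A_neq u v : u != v -> block B A u v = x *: block B M u v.
Proof.
by move=> uv; rewrite /A !blockB blockZ blockB (block1_neq K B_part uv) !sub0r scalerN opprK.
Qed.

Lemma block_A_diag a : block B A a a = 1%:M - x *: (1%:M - block B M a a).
Proof. by rewrite /A !blockB blockZ blockB block1. Qed.

Lemma nonedge_block u v : u != v -> ~~ G v u -> block B M u v = 0.
Proof.
move=> uv; rewrite negbK blockB (block1_neq K B_part uv) sub0r oppr_eq0.
by move/eqP.
Qed.

(** This trades the condition of not revisiting [a] for its deletion from the graph. *)
Lemma path_setU1 X a u s : u != a ->
  path (E (a |: X)%SET) u s = path (E X) u s && (a \notin s).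
Proof.
elim: s u => //= v s IH u ua; rewrite !edgeE !inE !negb_or (eq_sym a v) ua /=.
have [->|va] /= := eqVneq v a; first by rewrite !andbF.
by rewrite IH // andbA.
Qed.

Lemma is_path_nil X a w : a \notin X -> w \notin X -> w != a -> is_path (E X) a [::] w = G a w.
Proof. by move=> aX wX wa; rewrite /is_path /= edgeE aX wX inE eq_sym wa !andbT. Qed.

Lemma is_path_cons X a u s w :
  is_path (E X) a (u :: s) w = E X a u && is_path (E (a |: X)%SET) u s w.
Proof.
rewrite /is_path.
change (path (E X) a (rcons (u :: s) w)) with (E X a u && path (E X) u (rcons s w)).
have [Eau|//] := boolP (E X a u).
have ua : u != a by move: Eau; rewrite edgeE eq_sym => /and4P[].
rewrite path_setU1 // [uniq (a :: _)]/= inE negb_or (eq_sym a u) ua /=.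
by rewrite -!andbA.
Qed.

(** [cinv_offdiag] is iterated: the vertex just left is deleted, and the path goes on in the smaller
    graph. Each step contributes [- x], since off the diagonal the blocks of [A] are [x] times those
    of [M]. *)
Lemma cinv_path_sum k X a w : a \notin X -> w \notin X -> w != a -> (#|~: X| <= k)%N ->
  block B (cinv B A X) w a =
  \sum_(s <- seqs_upto 'I_n k | is_path (E X) a s w)
    (- x) ^+ (size s).+1 *:
    (W (a |: X :|: [set:: s])%SET w *m walk_product M W (a |: X)%SET a s w *m W X a).
Proof.
elim: k X a => [|k IH] X a aX wX wa.
  by rewrite leqn0 finset.cards_eq0 => /eqP/finset.setP/(_ a); rewrite !inE aX.
move=> Xk; have wY : w \notin (a |: X)%SET by rewrite !inE negb_or wa.
have Yk := card_setCU1 aX Xk.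
have step u : u \notin (a |: X)%SET ->
    - (block B (cinv B A (a |: X)) w u *m block B A u a *m W X a) =
    (- x) *: (block B (cinv B A (a |: X)) w u *m block B M u a *m W X a).
  rewrite !inE negb_or => /andP[ua _].
  by rewrite block_A_neq // -scalemxAr -scalemxAl scaleNr.
rewrite (cinv_offdiag B_part A_trunc aX wY) -sumrN (eq_bigr _ step).
(* The term at [w] is the path without internal vertices; the others are sorted by first internal
   vertex. *)
rewrite big_seqs_uptoS (bigD1 w) //=; congr (_ + _).
  rewrite is_path_nil // expr1 (_ : [set:: [::]] = finset.set0) ?finset.setU0.
    by case: ifP => // /negbT/nonedge_block -> //; rewrite mulmx0 mul0mx scaler0.
  by apply/finset.setP => i; rewrite !inE.
rewrite [RHS](bigID (fun u => (u \notin (a |: X)%SET) && (u != w))) /=.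
rewrite [X in _ = _ + X]big1 ?addr0 => [|u]; last first.
  rewrite negb_and !negbK => uY; apply: big1 => s; rewrite is_path_cons => /andP[].
  rewrite edgeE => /and4P[_ _ uX au] /andP[_ us]; case/orP: uY.
    by rewrite !inE (negPf uX) orbF eq_sym (negPf au).
  by move=> /eqP uw; move: us; rewrite uw /= mem_rcons mem_head.
apply: eq_bigr => u /andP[uY uw].
have uaX : (u != a) && (u \notin X) by move: uY; rewrite !inE negb_or.
rewrite (IH _ _ uY wY _ Yk) 1?eq_sym //.
have [Gau|nGau] := boolP (G a u); last first.
  case/andP: (uaX) => ua uX.
  rewrite (nonedge_block ua nGau) mulmx0 mul0mx scaler0 big1 // => s.
  by rewrite is_path_cons edgeE (negPf nGau).
rewrite mulmx_suml mulmx_suml scaler_sumr.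
apply: eq_big => s.
  by case/andP: uaX => ua uX; rewrite is_path_cons edgeE Gau aX uX eq_sym ua.
move=> _; rewrite /= -!scalemxAl scalerA -exprS; congr (_ *: _).
have -> : (u |: (a |: X) :|: [set:: s])%SET = (a |: X :|: [set:: u :: s])%SET.
  apply/finset.setP => i; rewrite !inE.
  by case: (i == u); case: (i == a); case: (i \in X); case: (i \in s).
congr (_ *m _); exact: mulmxA4.
Qed.

(* [u :: s] is the rest of a bare cycle off [a], where [a] already belongs to
   the set [X] of deleted vertices. *)
Let tail X a u s := [&& path (E X) u s, uniq (u :: s) & G (last u s) a].

Lemma tail_cons X a u v s : tail X a u (v :: s) = E X u v && tail (u |: X)%SET a v s.
Proof.
rewrite /tail.
change (path (E X) u (v :: s)) with (E X u v && path (E X) v s).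
have [Euv|//] := boolP (E X u v).
have vu : v != u by move: Euv; rewrite edgeE eq_sym => /and4P[].
rewrite path_setU1 // [uniq (u :: _)]/= inE negb_or (eq_sym u v) vu /=.
by rewrite -!andbA.
Qed.

Lemma is_bare_cycle_cons X a u s : is_bare_cycle (E X) a (u :: s) =
  E X a u && tail (a |: X)%SET a u s.
Proof.
rewrite /is_bare_cycle /tail.
change (path (E X) a (rcons (u :: s) a)) with (E X a u && path (E X) u (rcons s a)).
have [Eau|//] := boolP (E X a u).
have /and4P[_ aX uX _] : [&& G a u, a \notin X, u \notin X & a != u] by rewrite -edgeE.
have ua : u != a by move: Eau; rewrite edgeE eq_sym => /and4P[].
have lX : path (E X) u s -> last u s \notin X.
  elim: (s) (u) uX => //= v t IH w wX; rewrite edgeE.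
  by move=> /andP[/and4P[_ _ vX _]]; apply: IH.
have la : a \notin s -> last u s != a.
  move=> ais; have := mem_last u s; apply: contraTneq => ->.
  by rewrite inE negb_or eq_sym ua.
rewrite rcons_path path_setU1 // cons_uniq [a \in _ :: _]inE negb_or (eq_sym a u) ua andTb.
case: (path (E X) u s) lX => // /(_ isT) lX; rewrite !andTb.
case: (a \in s) la => [_|/(_ isT) la]; rewrite ?andbF // edgeE lX aX la !andbT.
by rewrite andbC.
Qed.

(** [cinv_offdiag] splits off the vertex [t] that follows [u], after which [u] is deleted. The
    induction collects the ways of returning to [a], the term [v = u] being the immediate return. *)
Lemma sum_cinv_tail k X a u : a \in X -> u \notin X -> (#|~: X| <= k)%N ->
  \sum_(v | v \notin X) block B M a v *m block B (cinv B A X) v u =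
  \sum_(s <- seqs_upto 'I_n k | tail X a u s)
    (- x) ^+ size s *: (walk_product M W (u |: X)%SET u s a *m W X u).
Proof.
elim: k X u => [|k IH] X u aX uX.
  by rewrite leqn0 finset.cards_eq0 => /eqP/finset.setP/(_ u); rewrite !inE uX.
move=> Xk; have Yk := card_setCU1 uX Xk.
have au : a != u by apply: contraNneq uX => <-.
have aY : a \in (u |: X)%SET by rewrite !inE aX orbT.
have notY v : (v \notin (u |: X)%SET) = (v \notin X) && (v != u).
  by rewrite !inE negb_or andbC.
rewrite big_seqs_uptoS (bigD1 u) //=; congr (_ + _).
  rewrite /tail /= scale1r; case: ifP => // /negbT/nonedge_block -> //.
  by rewrite mul0mx.
transitivity (\sum_(v | v \notin (u |: X)%SET) \sum_(t | t \notin (u |: X)%SET)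
   (- x) *: (block B M a v *m block B (cinv B A (u |: X)%SET) v t
             *m block B M t u *m W X u)).
  apply: eq_big => [v|v vX]; first by rewrite notY.
  have vY : v \notin (u |: X)%SET by rewrite notY.
  rewrite (cinv_offdiag B_part A_trunc uX vY) mulmxN mulmx_sumr -sumrN.
  apply: eq_bigr => t; rewrite notY => /andP[_ tu].
  by rewrite block_A_neq // -scalemxAr -scalemxAl -scalemxAr !mulmxA scaleNr.
rewrite exchange_big /= [RHS](bigID (fun t => t \notin (u |: X)%SET)) /=.
rewrite [X in _ = _ + X]big1 ?addr0 => [|t]; last first.
  rewrite notY negb_and !negbK => tY; apply: big1 => s; rewrite tail_cons => /andP[].
  by rewrite edgeE => /and4P[_ _ tX ut]; move: tY; rewrite (negPf tX) eq_sym (negPf ut).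
apply: eq_bigr => t tY; have /andP[tX tu] : (t \notin X) && (t != u) by rewrite -notY.
rewrite -scaler_sumr -!mulmx_suml (IH _ _ aY tY Yk).
have [Gut|nGut] := boolP (G u t); last first.
  rewrite (nonedge_block tu nGut) mulmx0 mul0mx scaler0 big1 // => s.
  by rewrite tail_cons edgeE (negPf nGut).
rewrite !mulmx_suml scaler_sumr; apply: eq_big => s.
  by rewrite tail_cons edgeE Gut tX uX eq_sym tu.
by move=> _; rewrite /= -!scalemxAl scalerA -exprS.
Qed.

(** The double sum in the Schur complement runs over the first and the last internal vertex of a
    bare cycle; its two blocks of [A] give [(- x) ^+ 2], and [sum_cinv_tail] expands what lies
    between. *)
Lemma F_bracket_cinv X a : a \notin X ->
  W X a = invmx (F_bracket M x W X a).
Proof.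
move=> aX; rewrite /W (cinv_diag B_part A_trunc aX) block_A_diag; congr (invmx (_ - _)).
rewrite (big_bseq n (is_bare_cycle (E X) a)
   (fun s : seq 'I_n => (- x) ^+ (size s).+1 *: walk_product M W (a |: X)%SET a s a)).
have [m nm] : exists m, n = m.+1 by case: (n) a {aX} => [[]|m _] //; exists m.
have Xm : (#|~: X| <= m.+1)%N by rewrite -nm -[X in (_ <= X)%N]card_ord max_card.
have Ym := card_setCU1 aX Xm.
have sE : seqs_upto 'I_n n = seqs_upto 'I_n m.+1 by congr seqs_upto.
(* The empty internal sequence would be a self-loop, and these are deleted. *)
rewrite sE big_seqs_uptoS /is_bare_cycle /= edgeE eqxx !andbF add0r.
rewrite exchange_big /= [RHS](bigID (fun u => u \notin (a |: X)%SET)) /=.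
rewrite [X in _ = _ + X]big1 ?addr0 => [|u]; last first.
  rewrite negbK !inE => uY; apply: big1 => s; rewrite -/(is_bare_cycle (E X) a (u :: s)).
  rewrite is_bare_cycle_cons edgeE => /andP[/and4P[_ _ uX au] _].
  by move: uY; rewrite (negPf uX) eq_sym (negPf au).
apply: eq_bigr => u uY; have /andP[ua uX] : (u != a) && (u \notin X).
  by move: uY; rewrite !inE negb_or.
transitivity ((- x) ^+ 2 *: (\sum_(v | v \notin (a |: X)%SET)
  block B M a v *m block B (cinv B A (a |: X)%SET) v u *m block B M u a)).
  rewrite scaler_sumr; apply: eq_bigr => v; rewrite !inE negb_or => /andP[va vX].
  rewrite (block_A_neq ua) block_A_neq 1?eq_sym // -!scalemxAl -scalemxAr scalerA.
  by rewrite sqrrN expr2.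
rewrite -mulmx_suml (@sum_cinv_tail m) ?finset.setU11 //.
have [Gau|nGau] := boolP (G a u); last first.
  rewrite (nonedge_block ua nGau) mulmx0 scaler0 big1 // => s.
  by rewrite -/(is_bare_cycle (E X) a (u :: s)) is_bare_cycle_cons edgeE (negPf nGau).
rewrite mulmx_suml scaler_sumr; apply: eq_big => s.
  by rewrite -/(is_bare_cycle (E X) a (u :: s)) is_bare_cycle_cons edgeE Gau aX uX eq_sym ua.
by move=> _; rewrite -!scalemxAl scalerA -exprD.
Qed.

(** Both sides obey the same recursion, by induction on the number of remaining vertices. *)
Lemma pathsum_F_cinv X a : a \notin X -> pathsum_F B M x X a = W X a.
Proof.
move: {2}#|~: X|.+1 (ltnSn #|~: X|) => k; elim: k X a => // k IH X a Xk aX.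
rewrite pathsum_FE // F_bracket_cinv //; congr invmx.
apply: eq_F_bracket => Y u aXY uY; apply: IH => //.
apply: (@leq_ltn_trans #|~: (a |: X)%SET|).
  by rewrite fintype.subset_leq_card // finset.setCS.
exact: leq_trans (ltn_card_setCU1 aX) Xk.
Qed.

Lemma block_inv_diag a : block B (invmx A) a a = pathsum_F B M x finset.set0 a.
Proof. by rewrite pathsum_F_cinv ?inE // /W /cinv truncate0. Qed.

Lemma block_inv_offdiag a w : w != a ->
  block B (invmx A) w a =
  \sum_(s : n.-bseq 'I_n | is_path (delete_loops G) a s w)
    (- x) ^+ (size s).+1 *:
    (pathsum_F B M x (a |: [set:: s])%SET w
      *m walk_product M (pathsum_F B M x) [set a]%SET a s w *m pathsum_F B M x finset.set0 a).
Proof.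
move=> wa; rewrite (big_bseq n (fun s : seq 'I_n => is_path (delete_loops G) a s w)
   (fun s : seq 'I_n => (- x) ^+ (size s).+1 *:
    (pathsum_F B M x (a |: [set:: s])%SET w
      *m walk_product M (pathsum_F B M x) [set a]%SET a s w *m pathsum_F B M x finset.set0 a))).
have -> : invmx A = cinv B A finset.set0 by rewrite /cinv truncate0.
rewrite (@cinv_path_sum n) ?inE //; last by rewrite -[X in (_ <= X)%N]card_ord max_card.
have EE : E finset.set0 = delete_loops G.
  by apply/funext => u; apply/funext => v; rewrite edgeE !inE.
rewrite EE; apply: eq_bigr => s /andP[_ us].
move: us; rewrite cons_uniq mem_rcons rcons_uniq inE negb_or.
move=> /andP[/andP[_ asn] /andP[ws us]].
rewrite finset.setU0 !pathsum_F_cinv ?inE //; last by rewrite negb_or wa.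
congr (_ *: (_ *m _ *m _)); apply/esym/eq_walk_product => //.
  by move=> Y u _ uY; apply: pathsum_F_cinv.
by move=> u us'; rewrite !inE; apply: contraNneq asn => <-.
Qed.

End PathSumInverse.

(** * Integration of path sums *)

(** Each determinant is a polynomial in [c] with value 1 at 0, so the product over all [X] is a
    nonzero polynomial; [rs] lists its roots. *)
Lemma truncate_unit_generic (K : closedFieldType) D n (B : 'I_n -> {set 'I_D}) (M : 'M[K]_D) :
  exists rs : seq K, forall c, c \notin rs -> forall X : {set 'I_n},
    truncate B (1%:M - c *: (1%:M - M)) X \in unitmx.
Proof.
pose P (X : {set 'I_n}) : 'M[{poly K}]_D := \matrix_(i, j)
  if (i \in \bigcup_(mu in X) B mu)%SET || (j \in \bigcup_(mu in X) B mu)%SET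
  then (i == j)%:R else ((i == j)%:R - 'X * ((1%:M - M) i j)%:P).
have PE X c : (\det (P X)).[c] = \det (truncate B (1%:M - c *: (1%:M - M)) X).
  rewrite -[LHS]/(horner_eval c _) -det_map_mx; congr (\det _); apply/matrixP => i j.
  rewrite [LHS]mxE ![in RHS]mxE mxE; case: ifP => _.
    by rewrite rmorph_nat.
  by rewrite rmorphB rmorphM rmorph_nat /= /horner_eval hornerX hornerC !mxE.
have P0 X : \det (P X) != 0.
  apply/eqP => /(congr1 (horner^~ 0)); rewrite PE scale0r subr0 horner0.
  rewrite (_ : truncate _ _ _ = 1%:M) ?det1; first by move/eqP; rewrite oner_eq0.
  by apply/matrixP => i j; rewrite !mxE if_same.
have [rs rsE] := closed_field_poly_normal (\prod_X \det (P X)).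
have prod0 : \prod_X \det (P X) != 0 by apply/prodf_neq0 => X _; apply: P0.
exists rs => c crs X; rewrite unitmxE unitfE -PE; apply: contraNneq crs => Pc.
have lead0 : lead_coef (\prod_X \det (P X)) != 0 by rewrite lead_coef_eq0.
rewrite -root_prod_XsubC -(rootZ _ _ lead0) -rsE.
by rewrite /root horner_prod; apply/prodf_eq0; exists X => //; rewrite Pc.
Qed.

Section AlmostEverywhere.
Variable R : realType.
Local Notation C := (complexNF R).
Local Notation mu := (@lebesgue_measure R).

Lemma integral01_off_finite (rs : seq R) (f g : R -> R) : cont01 g ->
  (forall x, 0 <= x <= 1 -> x \notin rs -> f x = g x) ->
  mu.-integrable `[0%R, 1%R] (EFin \o f) /\
  (\int[mu]_(x in `[0%R, 1%R]) f x = \int[mu]_(x in `[0%R, 1%R]) g x)%R.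
Proof.
move=> /cont01_integrable ig fg; pose N := [set` rs]; pose D : set R := [set` `[(0 : R), 1]].
have cN (A : set R) : countable (A `&` N).
  apply: (sub_countable (B := N)); first by apply: subset_card_le => x [].
  by apply: finite_set_countable; exact: finite_seq.
have mN (A : set R) : measurable (A `&` N).
  by apply: countable_measurable => // t; exact: measurable_set1.
have mN' : measurable N by rewrite -[N]setTI.
have N0 : mu N = 0%E by rewrite -[N]setTI; apply: countable_lebesgue_measure0.
have mD : measurable D by exact: measurable_itv.
have fgN : {in D `\` N, EFin \o g =1 EFin \o f}.
  move=> x; rewrite inE => -[xD /negP xN] /=; rewrite fg //.
have mg := measurable_int _ ig.
have iN := (negligible_integrable (mu := mu) mN' mD mg N0).1 ig.
have iNf : mu.-integrable (D `\` N) (EFin \o f).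
  by apply: eq_integrable iN => //; apply: measurableD.
(* Integrability extends across the null set once [f] is measurable; on a finite set this holds
   since all its subsets are measurable. *)
have if_ : mu.-integrable D (EFin \o f).
  apply: (negligible_integrable (mu := mu) mN' mD _ N0).2 => //.
  rewrite (_ : D = (D `\` N) `|` (D `&` N)); last by rewrite setUC setUIDK.
  have mDN : measurable (D `\` N) by exact: measurableD.
  apply: (measurable_funU _ mDN (mN D)).2; split; first exact: (measurable_int mu iNf).
  move=> _ Y mY; rewrite setIC setIA; exact: mN.
split=> //; rewrite /Rintegral; congr fine.
rewrite (negligible_integral (mu := mu) mN' mD if_ N0).
rewrite (negligible_integral (mu := mu) mN' mD ig N0).
by apply: eq_integral => x xDN; have := fgN x xDN.
Qed.

Lemma mx_integral01_off_finite p q (rs : seq R) (f g : R -> 'M[C]_(p, q)) : mcont01 g ->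
  (forall x, 0 <= x <= 1 -> x \notin rs -> f x = g x) ->
  mx_integrable01 f /\ mx_integral01 f = mx_integral01 g.
Proof.
move=> cg fg.
have hR i j := @integral01_off_finite rs (fun x => complex.Re (f x i j)) _
  (cont01_Re (cg i j))
  (fun x xI xr => congr1 (fun A : 'M[C]_(p, q) => complex.Re (A i j)) (fg x xI xr)).
have hI i j := @integral01_off_finite rs (fun x => complex.Im (f x i j)) _
  (cont01_Im (cg i j))
  (fun x xI xr => congr1 (fun A : 'M[C]_(p, q) => complex.Im (A i j)) (fg x xI xr)).
split; first by move=> i j; split; [exact: (hR i j).1|exact: (hI i j).1].
by apply/matrixP => i j; rewrite !mxE (hR i j).2 (hI i j).2.
Qed.

Lemma mcont01_integrable p q (f : R -> 'M[C]_(p, q)) : mcont01 f -> mx_integrable01 f.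
Proof. by move=> cf; have [] := @mx_integral01_off_finite p q [::] f f cf. Qed.

Lemma mx_integral01D p q (f g : R -> 'M[C]_(p, q)) : mcont01 f -> mcont01 g ->
  mx_integral01 (fun x => f x + g x) = mx_integral01 f + mx_integral01 g.
Proof.
move=> /mcont01_integrable cf /mcont01_integrable cg; apply/matrixP => i j; rewrite !mxE.
have [fr fi] := cf i j; have [gr gi] := cg i j.
under eq_Rintegral do rewrite mxE ReD.
under [X in _ +i* X = _]eq_Rintegral do rewrite mxE ImD.
by rewrite !RintegralD.
Qed.

Lemma mx_integral01_sum p q (I : Type) (s : seq I) (P : pred I)
    (f : I -> R -> 'M[C]_(p, q)) :
  (forall i, P i -> mcont01 (f i)) ->
  mx_integral01 (fun x => \sum_(i <- s | P i) f i x) =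
  \sum_(i <- s | P i) mx_integral01 (f i).
Proof.
move=> cf; elim: s => [|i s IH].
  rewrite big_nil; under eq_fun do rewrite big_nil.
  apply/matrixP => i j; rewrite !mxE.
  by rewrite !Rintegral_cst //= !mul0r.
rewrite big_cons; under eq_fun do rewrite big_cons.
case: ifP => Pi //; rewrite -IH -mx_integral01D //; first exact: cf.
exact: mcont01_sum.
Qed.

Lemma block_mx_integral01 D n (B : 'I_n -> {set 'I_D}) (A : R -> 'M[C]_D) a b :
  block B (mx_integral01 A) a b = mx_integral01 (fun x => block B (A x) a b).
Proof.
apply/matrixP => i j; rewrite blockE !mxE.
by congr (_ +i* _); apply: eq_Rintegral => x _; rewrite blockE.
Qed.

Lemma mcont01_block D n (B : 'I_n -> {set 'I_D}) (A : R -> 'M[C]_D) a b :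
  mcont01 A -> mcont01 (fun x => block B (A x) a b).
Proof. by move=> cA i j; under eq_fun do rewrite blockE; apply: cA. Qed.

End AlmostEverywhere.

(** * Continuity of the path sums *)

Section PathsumContinuity.
Variables (R : realType) (D n : nat) (B : 'I_n -> {set 'I_D}).
Local Notation C := (complexNF R).
Variable M : 'M[C]_D.

Lemma mcont01_walk_product (F : R -> {set 'I_n} -> forall a, 'M[C]_#|B a|)
    (X : {set 'I_n}) v s w :
  (forall s1 mu s2, s = s1 ++ mu :: s2 -> mcont01 (fun x => F x (X :|: [set:: s1])%SET mu)) ->
  mcont01 (fun x => walk_product M (F x) X v s w).
Proof.
elim: s X v => [|u s IH] X v cF /=; first exact: mcont01_cst.
apply: mcont01_mul; last exact: mcont01_cst.
apply: mcont01_mul.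
  apply: IH => s1 mu s2 sE.
  have -> : (u |: X :|: [set:: s1])%SET = (X :|: [set:: u :: s1])%SET.
    by apply/finset.setP => i; rewrite !inE orbCA orbA.
  by apply: (cF _ _ s2); rewrite sE.
have := cF [::] u s erefl.
by have -> : (X :|: [set:: [::]])%SET = X by apply/finset.setP => i; rewrite !inE orbF.
Qed.

(** Inverses of truncations may be unbounded near an exceptional point; the existence of the
    required inverses on all of [[0, 1]] excludes this for each factor, so that path terms can be
    integrated one by one. *)
Lemma mcont01_pathsum_F (X : {set 'I_n}) a : a \notin X ->
  (forall x, 0 <= x <= 1 -> F_exists B M x%:C X a) ->
  mcont01 (fun x => pathsum_F B M x%:C X a).
Proof.
move: {2}#|~: X|.+1 (ltnSn #|~: X|) => k; elim: k X a => // k IH X a Xk aX Fex.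
have cC : cont01 (fun x : R => x%:C : C) := @cont01_real_complex R.
under eq_fun do rewrite pathsum_FE //.
apply: mcont01_inv; first by move=> x /Fex[].
apply: mcont01B.
  apply: mcont01B; first exact: mcont01_cst.
  by apply: mcont01Z; [exact: cC|exact: mcont01_cst].
apply: mcont01_sum => s cyc; apply: mcont01Z.
  by apply: cont01X; apply: cont01N.
have aXC u : u \in (s : seq 'I_n) -> u \notin (a |: X)%SET.
  move: cyc => /andP[ps /= /andP[aNs us]] us'.
  rewrite finset.in_setU1 negb_or; apply/andP; split.
    by apply: contraNneq aNs => <-.
  have path_avoid : forall b t, path (delete_loops (delete_vertices X
      (partition_graph B (1%:M - M)))) b (rcons t a) -> {in t, forall v, v \notin X}.
    move=> b t; elim: t b => //= t0 t IHt b /andP[/andP[/and3P[_ _ t0X] _] /IHt tX] v.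
    by rewrite inE => /predU1P[->//|/tX].
  exact: path_avoid ps u us'.
apply: mcont01_walk_product => s1 mu s2 sE; apply: IH.
- apply: leq_ltn_trans (_ : (#|~: (a |: X)%SET| < k)%N).
    by rewrite fintype.subset_leq_card // finset.setCS finset.subsetUl.
  exact: leq_trans (ltn_card_setCU1 aX) Xk.
- rewrite finset.in_setU negb_or aXC; last by rewrite sE mem_cat mem_head orbT.
  rewrite andTb inE.
  move: cyc => /andP[_ /=]; rewrite sE cat_uniq => /and4P[_ _ + _].
  by rewrite /= negb_or => /andP[].
- by move=> x /Fex[+ _]; apply; [exact: cyc|exact: sE].
Qed.

End PathsumContinuity.

Lemma log_kernelE (R : realType) D (M : 'M[complexNF R]_D) (x : R) :
  pencil M x \in unitmx -> x != 0 ->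
  log_kernel M x = x%:C^-1 *: (1%:M - invmx (pencil M x)).
Proof.
move=> uP x0; have xC : x%:C != 0 :> R[i] by rewrite (fmorph_eq0 (real_complex R)).
rewrite /log_kernel (_ : M - 1%:M = x%:C^-1 *: (pencil M x - 1%:M)); last first.
  by rewrite /pencil addrAC subrr sub0r -scalerN opprB scalerA mulVf ?scale1r.
by rewrite -scalemxAl mulmxBl mulmxV // mul1mx.
Qed.

Local Close Scope classical_set_scope.

Theorem theorem3p5 (R : realType) (D n : nat) (M : 'M[R[i]]_D)
    (B : 'I_n -> {set 'I_D}) :
  (forall r : R, r <= 0 -> ~~ eigenvalue M r%:C) ->
  coord_partition B ->
  let G0 := delete_loops (partition_graph B (1%:M - M)) in
  let F (x : R) := pathsum_F B M x%:C in
  (forall alpha : 'I_n,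
     (forall x : R, 0 <= x <= 1 -> F_exists B M x%:C finset.set0 alpha) ->
     let f (x : R) := x%:C^-1 *: (1%:M - F x finset.set0 alpha) in
     mx_integrable01 f /\
     block B (principal_log M) alpha alpha = mx_integral01 f) /\
  (forall alpha omega : 'I_n, omega != alpha ->
     (forall x : R, 0 <= x <= 1 ->
        forall s, is_path G0 alpha s omega ->
        forall s1 mu s2, alpha :: rcons s omega = s1 ++ mu :: s2 ->
        F_exists B M x%:C [set:: s1]%SET mu) ->
     let f (s : seq 'I_n) (x : R) :=
       (- x%:C) ^+ (size s) *:
         (F x (alpha |: [set:: s])%SET omega
          *m walk_product M (F x) [set alpha]%SET alpha s omega
          *m F x finset.set0 alpha) in
     (forall s, is_path G0 alpha s omega -> mx_integrable01 (f s)) /\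
     block B (principal_log M) omega alpha =
       \sum_(s : n.-bseq 'I_n | is_path G0 alpha s omega) mx_integral01 (f s)).
Proof.
move=> Msp Bp G0 F.
have [rsC rsP] := truncate_unit_generic B M.
(* A real exceptional parameter is its own real part; 0 is added because of the factor [x^-1]. *)
pose rs : seq R := 0 :: map (fun z : R[i] => complex.Re z) rsC.
have good (x : R) : x \notin rs -> x != 0 /\ forall X, truncate B (pencil M x) X \in unitmx.
  rewrite inE negb_or => /andP[x0 xr]; split=> // X; apply: rsP.
  by apply: contra xr => /(map_f (fun z : R[i] => complex.Re z)).
have gpencil (x : R) : x \notin rs -> pencil M x \in unitmx.
  by move=> /good[_ /(_ finset.set0)]; rewrite truncate0.
have cK := mcont01_log_kernel Msp.
rewrite (principal_logE Msp); split=> [alpha _ f|alpha omega wa Fex f].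
  rewrite block_mx_integral01.
  (* Off [rs], the integrand is a diagonal block of the continuous [log_kernel], whose integral it
     inherits. *)
  have fE (x : R) : 0 <= x <= 1 -> x \notin rs ->
      f x = block B (log_kernel M x) alpha alpha.
    move=> _ xr; have [x0 xt] := good x xr.
    rewrite log_kernelE ?gpencil // blockZ blockB block1.
    by rewrite (block_inv_diag Bp xt).
  by have [fi ->] := mx_integral01_off_finite (@mcont01_block R D n B _ alpha alpha cK) fE.
have cf s : is_path G0 alpha s omega -> mcont01 (f s : R -> 'M[complexNF R]_(_, _)).
  move=> sP; have /andP[_ us] := sP.
  have us' : uniq (alpha :: rcons s omega) := us.
  move: us; rewrite cons_uniq mem_rcons inE negb_or rcons_uniq.
  move=> /andP[/andP[_ als] /andP[ws us]].
  (* Every factor, those of the two end points included, is the [F] of a vertex of the path with the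
     preceding ones deleted. *)
  have cF s1 mu s2 : alpha :: rcons s omega = s1 ++ mu :: s2 ->
      mcont01 (fun x => F x [set:: s1]%SET mu : 'M[complexNF R]_(_, _)).
    move=> sE; apply: mcont01_pathsum_F => [|x xI]; last exact: Fex xI _ sP _ _ _ sE.
    by move: us'; rewrite sE cat_uniq /= negb_or inE => /and3P[_ /andP[]].
  have set_cons (a : 'I_n) t : (a |: [set:: t])%SET = [set:: a :: t]%SET.
    by apply/finset.setP => i; rewrite !inE.
  apply: mcont01Z; first by apply: cont01X; apply: cont01N; exact: cont01_real_complex.
  apply: mcont01_mul; first apply: mcont01_mul.
  - by rewrite set_cons; apply: (cF _ _ [::]); rewrite cats1 rcons_cons.
  - apply: mcont01_walk_product => s1 mu s2 sE.
    have -> : ([set alpha] :|: [set:: s1])%SET = [set:: alpha :: s1]%SET.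
      by rewrite set_cons.
    by apply: (cF _ _ (rcons s2 omega)); rewrite sE rcons_cat.
  - have -> : finset.set0 = [set:: [::] : seq 'I_n]%SET.
      by apply/finset.setP => i; rewrite !inE.
    exact: (cF _ _ (rcons s omega)).
split=> [s /cf/mcont01_integrable//|].
rewrite block_mx_integral01 -mx_integral01_sum => [|s /cf //].
symmetry.
apply: (mx_integral01_off_finite (rs := rs) (@mcont01_block R D n B _ omega alpha cK) _).2.
move=> x _ xr; have [x0 xt] := good x xr.
rewrite log_kernelE ?gpencil // blockZ blockB (block1_neq _ Bp wa) sub0r.
rewrite (block_inv_offdiag Bp xt wa) scalerN -scaleNr scaler_sumr.
(* The factor [- x^-1] cancels one factor [- x], leaving the exponent [size s], one less than the
   length of the path. *)
apply: eq_bigr => s _; rewrite scalerA exprS mulrA mulrNN mulVf ?mul1r //.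
by rewrite (fmorph_eq0 (real_complex R)).
Qed.
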